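(* Let $\delta\in(0,1)$ and $\varepsilon>0$. Suppose $\Theta\subset\mathbb{R}^p$ is compact and contained in a closed Euclidean ball of radius $r>0$, and $\boldsymbol\Psi:\Theta\to\mathbb{S}^m_{++}$ satisfies (i) $\|\boldsymbol\Psi(\boldsymbol\theta)-\boldsymbol\Psi(\boldsymbol\theta')\|_2\le L_\Psi\|\boldsymbol\theta-\boldsymbol\theta'\|_2$ for all $\boldsymbol\theta,\boldsymbol\theta'\in\Theta$, and (ii) $\alpha\mathbf{I}\preceq\boldsymbol\Psi(\boldsymbol\theta)\preceq\beta\mathbf{I}$ for all $\boldsymbol\theta\in\Theta$, with $0<\alpha\le\beta$; let $\kappa_\infty=\beta/\alpha$. Let $\widehat F_{\mathrm{SL}}$ be the SLQ estimator computed with $K$ Lanczos steps and $N$ independent Rademacher vectors (the same vectors for all $\boldsymbol\theta$). If $$K\ge \frac{\sqrt{\kappa_\infty+1}}{4}\log\Big(4\cdot\tfrac{5}{2}\varepsilon^{-1} m(\sqrt{\kappa_\infty+1}+1)\log(2\kappa_\infty)\Big),$$ $$N\ge 32\Big(\tfrac{25}{4}\varepsilon^{-2}\max_{\boldsymbol\theta\in\Theta}\|\overline{\log\boldsymbol\Psi(\boldsymbol\theta)}\|_F^2+\tfrac52\varepsilon^{-1}\max_{\boldsymbol\theta\in\Theta}\|\overline{\log\boldsymbol\Psi(\boldsymbol\theta)}\|_2\Big)\log\Big(\frac{2\gamma}{\delta}\Big),$$ where $\gamma=\max\{(3r/\eta)^p,1\}$ and $\eta=\alpha\varepsilon/(5mL_\Psi)$,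 then with probability at least $1-\delta$, $$\max_{\boldsymbol\theta\in\Theta}\big|\widehat F_{\mathrm{SL}}(\boldsymbol\theta)-\log\det(\boldsymbol\Psi(\boldsymbol\theta))\big|\le\varepsilon .$$
   Context: $\mathbb{S}^m_{++}$: symmetric positive definite $m\times m$ matrices. For a square matrix $\mathbf{B}$, $\overline{\mathbf{B}}=\mathbf{B}-\mathrm{diag}(\mathbf{B})$ denotes its off-diagonal part; $\|\cdot\|_F$ the Frobenius norm, $\|\cdot\|_2$ the spectral norm. Rademacher vectors $\mathbf{w}_i\in\{\pm1\}^m$ have i.i.d. entries uniform on $\{\pm1\}$. Stochastic Lanczos quadrature (SLQ) estimator: given independent Rademacher vectors $\mathbf{w}_1,\dots,\mathbf{w}_N$, for each $i$ run $K$ steps of the symmetric Lanczos algorithm on $\boldsymbol\Psi(\boldsymbol\theta)$ with starting vector $\mathbf{w}_i/\|\mathbf{w}_i\|_2$, producing a $K\times K$ tridiagonal matrix $\mathbf{T}_K^{(i)}$; this implicitly defines a polynomial $q_K$ (of degree at most $K-1$, depending on $i$ and $\boldsymbol\theta$) with $\mathbf{w}_i^\top q_K(\boldsymbol\Psi(\boldsymbol\theta))\mathbf{w}_i=\|\mathbf{w}_i\|_2^2\,\mathbf{e}_1^\top\log(\mathbf{T}_K^{(i)})\mathbf{e}_1$, and $\widehat F_{\mathrm{SL}}(\boldsymbol\theta)=\frac1N\sum_{i=1}^N \mathbf{w}_i^\top q_K(\boldsymbol\Psi(\boldsymbol\theta))\mathbf{w}_i$, an approximation of $\log\det\boldsymbol\Psi(\boldsymbol\theta)=\mathrm{trace}(\log\boldsymbol\Psi(\boldsymbol\theta))$.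 *)

(* Defs.v *)
From HB Require Import structures.
From mathcomp Require Import all_boot all_order all_algebra.
From mathcomp Require Import all_classical all_reals all_analysis.
Set Implicit Arguments. Unset Strict Implicit. Unset Printing Implicit Defensive.
Import Order.TTheory GRing.Theory Num.Theory numFieldNormedType.Exports.
Local Open Scope classical_set_scope.
Local Open Scope ring_scope.

Section Defs.
Variable R : realType.

(* Frobenius norm; on a row/column vector this is the Euclidean norm ||.||_2 *)
Definition frobnorm (a b : nat) (B : 'M[R]_(a, b)) : R :=
  Num.sqrt (\sum_(i < a) \sum_(j < b) B i j ^+ 2).

Definition specnorm (n : nat) (A : 'M[R]_n) : R :=
  sup [set frobnorm (A *m x) | x in [set x : 'cV[R]_n | frobnorm x <= 1]].

Definition offdiag (n : nat) (B : 'M[R]_n) : 'M[R]_n :=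
  \matrix_(i, j) (if i == j then 0 else B i j).

Definition sym_mx (n : nat) (A : 'M[R]_n) : Prop := A^T = A.

Definition loewner_le (n : nat) (A B : 'M[R]_n) : Prop :=
  forall x : 'cV[R]_n, 0 <= (x^T *m (B - A) *m x) 0 0.

Definition spd_decomp (n : nat) (A U : 'M[R]_n) (d : 'rV[R]_n) : Prop :=
  U^T *m U = 1%:M /\ A = U *m diag_mx d *m U^T /\ forall i, 0 < d 0 i.

(* matrix logarithm of a symmetric positive definite matrix:
   log A = U diag(log d) U^T for a spectral decomposition A = U diag(d) U^T
   (0 when A is not symmetric positive definite; never used in that case) *)
Definition matlog (n : nat) (A : 'M[R]_n) : 'M[R]_n :=
  match pselect (exists U d, spd_decomp A U d) with
  | left h => let (U, hU) := cid h in let (d, _) := cid hU in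
              U *m diag_mx (map_mx (@ln R) d) *m U^T
  | right _ => 0
  end.

Definition logdet (n : nat) (A : 'M[R]_n) : R := ln (\det A).

(* Symmetric Lanczos recursion (exact arithmetic). Given the current
   vector q_j, the previous one q_{j-1} and beta_{j-1}, it performs the
   remaining [k] steps and returns (alpha_j, ..., ) and (beta_j, ...).
   If beta_j = 0 (breakdown: the Krylov space is invariant) the process
   stops early, as is standard. *)
Fixpoint lanczos_aux (n : nat) (A : 'M[R]_n) (k : nat) (qprev q : 'cV[R]_n)
    (bprev : R) : seq R * seq R :=
  match k with
  | 0%N => ([::], [::])
  | k'.+1 =>
    let v := A *m q - bprev *: qprev in
    let a := (q^T *m v) 0 0 in
    let v' := v - a *: q in
    let b := frobnorm v' in
    if (k' == 0%N) || (b == 0) then ([:: a], [::])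
    else let ab := lanczos_aux A k' q (b^-1 *: v') b in
         (a :: ab.1, b :: ab.2)
  end.

Definition lanczos (n : nat) (A : 'M[R]_n) (K : nat) (w : 'cV[R]_n) :=
  lanczos_aux A K 0 ((frobnorm w)^-1 *: w) 0.

Definition tridiag (a b : seq R) : 'M[R]_(size a) :=
  \matrix_(i, j) (if i == j then a`_i
                  else if (i.+1 == j :> nat) then b`_i
                  else if (j.+1 == i :> nat) then b`_j else 0).

Definition e1 (n : nat) : 'cV[R]_n := \col_i (i == 0%N :> nat)%:R.

(* w^T q_K(A) w = ||w||^2 e_1^T log(T_K) e_1 *)
Definition lanczos_quad (n : nat) (A : 'M[R]_n) (K : nat) (w : 'cV[R]_n) : R :=
  let T := tridiag (lanczos A K w).1 (lanczos A K w).2 in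
  frobnorm w ^+ 2 * ((e1 _)^T *m matlog T *m e1 _) 0 0.

Definition slq (n : nat) (A : 'M[R]_n) (K N : nat) (w : 'I_N -> 'cV[R]_n) : R :=
  N%:R^-1 * \sum_(i < N) lanczos_quad A K (w i).

Definition rademacher (n : nat) (s : {ffun 'I_n -> bool}) : 'cV[R]_n :=
  \col_i (if s i then 1 else -1).

(* probability of an event under N independent Rademacher vectors in
   {+-1}^n, i.e. under the uniform distribution on sign patterns *)
Definition rad_prob (n N : nat) (E : ({ffun 'I_N -> {ffun 'I_n -> bool}}) -> Prop) : R :=
  #|[set W : {ffun 'I_N -> {ffun 'I_n -> bool}} | `[< E W >]]|%:R /
  #|{: {ffun 'I_N -> {ffun 'I_n -> bool}}}|%:R.

End Defs.

(* Main.v *)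
Require Import Defs.
From HB Require Import structures.
From mathcomp Require Import all_boot all_order all_algebra.
From mathcomp Require Import all_classical all_reals all_analysis.
From mathcomp Require Import ring lra zify.
From mathcomp Require Import complex.
From mathcomp Require spectral.
Set Implicit Arguments. Unset Strict Implicit. Unset Printing Implicit Defensive.
Import Order.TTheory GRing.Theory Num.Theory numFieldNormedType.Exports.
Local Open Scope classical_set_scope.
Local Open Scope ring_scope.

(** The error at theta is compared with the error at the nearest point theta_0
    of a net of radius 3 eta / 2, and split into four parts.

    - Lanczos quadrature integrates polynomials of degree < 2K exactly, so its
      error is at most 2m times the uniform distance from log to these
      polynomials on [alpha, beta].  The Chebyshev expansion
      ln (1 + 2 t q + q^2) = 2 sum_k (-1)^(k+1) q^k T_k(t) / k makes this at most
      eps / 5.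
    - The matrix logarithm is (1 / alpha)-Lipschitz in operator norm: the bound
      |S - T| <= |S^2 - T^2| / (2 s) for S, T >= s, iterated along 2^k-th roots,
      converges to it since 2^k (a^(2^-k) - 1) tends to ln a.  Moving from theta
      to theta_0 thus costs 3 eps / 10 in the quadratic forms and 3 eps / 10 in
      the trace.
    - At theta_0 the deviation from the trace is a Rademacher chaos of a
      zero-diagonal matrix B.  Integrating out the signs one by one bounds its
      moment generating function by det (1 - 2 lambda B)^(-1/2), as for Gaussian
      vectors; this gives eps / 5 with failure probability at most delta / gamma.

    A rho-separated set of n points in a ball of radius r satisfies
    n <= (1 + 2 r / rho)^p: nesting k scaled copies of it yields n^k points of
    comparable separation, which a grid bounds by C (1 + 2 r / rho)^(k p). *)

(** * Real spectral theorem *)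

(** Over the complex numbers an eigenvalue a exists. For a row eigenvector v with conjugate
    transpose w, v A w = a (v w) is its own conjugate and v w > 0, so a is real and hence a root of
    the real characteristic polynomial. *)
Lemma sym_eigen (R : realType) n (A : 'M[R]_n.+1) : A^T = A ->
  exists a, eigenvalue A a.
Proof.
move=> Asym.
set C := (complex.complex R : numClosedFieldType).
have [a Ha] := spectral.eigenvalue_closed (map_mx (real_complex R) A : 'M[C]_n.+1) (ltn0Sn n).
have areal : a \is Num.real.
  have /eigenvalueP [v vA vn0] := Ha.
  pose vs := map_mx Num.conj v^T.
  have conjAC : map_mx Num.conj (map_mx (real_complex R) A : 'M[C]_n.+1)^T = map_mx (real_complex R) A.
    apply/matrixP => i j; rewrite !mxE -[in RHS]Asym mxE.
    by apply/CrealP; apply/complex_realP; exists (A j i).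
  have E : map_mx Num.conj (v *m (map_mx (real_complex R) A : 'M[C]_n.+1) *m vs)^T
     = v *m (map_mx (real_complex R) A : 'M[C]_n.+1) *m vs.
    have vsK : map_mx Num.conj vs^T = v.
      by apply/matrixP => i j; rewrite !mxE conjCK.
    by rewrite !trmx_mul !map_mxM conjAC vsK mulmxA.
  have s_gt0 : 0 < (v *m vs) 0 0.
    rewrite mxE; under eq_bigr => j _ do rewrite !mxE -normCK.
    rewrite lt0r sumr_ge0 ?andbT => [|j _]; last by rewrite exprn_ge0.
    apply: contra vn0 => /eqP /psumr_eq0P H; apply/eqP/rowP => j; rewrite mxE.
    by apply/eqP; rewrite -normr_eq0 -sqrf_eq0 H // => ? _; rewrite exprn_ge0.
  have := congr1 (fun M : 'M[C]_(1,1) => M 0 0) E.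
  rewrite vA -scalemxAl !mxE rmorphM /=.
  move: s_gt0; rewrite mxE; set s := \sum_j _ => s0.
  have -> : (s^* = s)%R by apply/CrealP/gtr0_real.
  by move/(mulIf (lt0r_neq0 s0))/CrealP.
exists (complex.Re a).
move: Ha; rewrite !eigenvalue_root_char -(RRe_real areal).
by rewrite -map_char_poly fmorph_root.
Qed.

Section LinearAlgebra.
Variable R : realType.
Implicit Types n : nat.

Definition dot n (x y : 'cV[R]_n) : R := (x^T *m y) 0 0.
(** Operator bounds below take the form |qf A x| <= c dot x x; for symmetric A this bounds the
    spectral norm without a supremum. *)
Definition qf n (A : 'M[R]_n) (x : 'cV[R]_n) : R := dot x (A *m x).

Lemma dotE n (x y : 'cV[R]_n) : dot x y = \sum_i x i 0 * y i 0.
Proof. by rewrite /dot mxE; apply: eq_bigr => i _; rewrite mxE. Qed.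

Lemma dotC n (x y : 'cV[R]_n) : dot x y = dot y x.
Proof. by rewrite !dotE; apply: eq_bigr => i _; rewrite mulrC. Qed.

Lemma dotDr n (x y z : 'cV[R]_n) : dot x (y + z) = dot x y + dot x z.
Proof. by rewrite /dot mulmxDr mxE. Qed.

Lemma dotZr n c (x y : 'cV[R]_n) : dot x (c *: y) = c * dot x y.
Proof. by rewrite /dot -scalemxAr mxE. Qed.

Lemma dotNr n (x y : 'cV[R]_n) : dot x (- y) = - dot x y.
Proof. by rewrite /dot mulmxN mxE. Qed.

Lemma dotBr n (x y z : 'cV[R]_n) : dot x (y - z) = dot x y - dot x z.
Proof. by rewrite dotDr dotNr. Qed.

Lemma dotZl n c (x y : 'cV[R]_n) : dot (c *: x) y = c * dot x y.
Proof. by rewrite dotC dotZr dotC. Qed.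

Lemma dot0r n (x : 'cV[R]_n) : dot x 0 = 0.
Proof. by rewrite /dot mulmx0 mxE. Qed.

Lemma dot_mulmx m n (A : 'M[R]_(m, n)) (x : 'cV[R]_m) (y : 'cV[R]_n) :
  dot x (A *m y) = dot (A^T *m x) y.
Proof. by rewrite /dot trmx_mul trmxK mulmxA. Qed.

Lemma dot_ge0 n (x : 'cV[R]_n) : 0 <= dot x x.
Proof. by rewrite dotE sumr_ge0 // => i _; rewrite -expr2 sqr_ge0. Qed.

Lemma dot_eq0 n (x : 'cV[R]_n) : (dot x x == 0) = (x == 0).
Proof.
apply/eqP/eqP => [|->]; last by rewrite dot0r.
rewrite dotE => /psumr_eq0P H; apply/colP => i; rewrite mxE; apply/eqP.
by rewrite -sqrf_eq0 expr2 H // => j _; rewrite -expr2 sqr_ge0.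
Qed.

Lemma frobnorm_ge0 m n (A : 'M[R]_(m, n)) : 0 <= frobnorm A.
Proof. exact: sqrtr_ge0. Qed.

Lemma frobnorm_sqr m n (A : 'M[R]_(m, n)) :
  frobnorm A ^+ 2 = \sum_i \sum_j A i j ^+ 2.
Proof.
by rewrite sqr_sqrtr // sumr_ge0 // => i _; rewrite sumr_ge0 // => j _; rewrite sqr_ge0.
Qed.

Lemma frobnorm_dot n (x : 'cV[R]_n) : frobnorm x ^+ 2 = dot x x.
Proof.
by rewrite frobnorm_sqr dotE; apply: eq_bigr => i _; rewrite big_ord1 expr2.
Qed.

Lemma orthoV n (U : 'M[R]_n) : U^T *m U = 1%:M -> U *m U^T = 1%:M.
Proof. exact: mulmx1C. Qed.

Lemma dot_ortho n k (U : 'M[R]_(n, k)) (x y : 'cV[R]_k) :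
  U^T *m U = 1%:M -> dot (U *m x) (U *m y) = dot x y.
Proof. by move=> h; rewrite dot_mulmx mulmxA h mul1mx. Qed.

(* H is the Householder reflection exchanging e_0 and u. *)
Lemma householder n (u : 'cV[R]_n.+1) : dot u u = 1 ->
  exists H : 'M[R]_n.+1, [/\ H^T = H, H *m H = 1%:M & H *m delta_mx 0 0 = u].
Proof.
move=> u1; pose e : 'cV[R]_n.+1 := delta_mx 0 0.
have e1 : dot e e = 1.
  by rewrite /dot /e trmx_delta mul_delta_mx mxE !eqxx.
have [->|une] := eqVneq u e; first by exists 1%:M; rewrite trmx1 !mul1mx.
pose v := u - e.
have vv0 : dot v v != 0 by rewrite dot_eq0 subr_eq0.
have vvE : dot v v = - (2 * dot v e).
  by rewrite /v !dotBr ![dot (u - e) _]dotC !dotBr u1 e1 (dotC u e); ring.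
have vTv : v^T *m v = (dot v v)%:M by rewrite [LHS]mx11_scalar.
have vTe : v^T *m e = (dot v e)%:M by rewrite [LHS]mx11_scalar.
exists (1%:M - (2 / dot v v) *: (v *m v^T)); split.
- by rewrite linearB /= linearZ /= trmx1 trmx_mul trmxK.
- have PP : (v *m v^T) *m (v *m v^T) = dot v v *: (v *m v^T).
    by rewrite mulmxA -(mulmxA v) vTv mul_mx_scalar -scalemxAl.
  rewrite mulmxBl mul1mx mulmxBr mulmx1 -!scalemxAl -!scalemxAr PP !scalerA.
  rewrite (_ : 2 / dot v v * (2 / dot v v) * dot v v = 2 / dot v v + 2 / dot v v).
    by rewrite scalerDl opprB addrK subrK.
  by field.
- have cE : 2 / dot v v * dot v e = -1.
    move: vv0; rewrite vvE => h; field.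
    by apply: contra h => /eqP ->; rewrite mulr0 oppr0.
  rewrite mulmxBl mul1mx -scalemxAl -mulmxA vTe mul_mx_scalar scalerA cE.
  by rewrite scaleN1r opprK addrC subrK.
Qed.

(** Induction on the size. Conjugation by the reflection taking e_0 to a unit eigenvector makes the
    first column a multiple of e_0; by symmetry the result is block diagonal, and the induction
    hypothesis diagonalizes the lower block. *)
Theorem sym_spectral n (A : 'M[R]_n) : A^T = A ->
  exists (U : 'M[R]_n) (d : 'rV[R]_n), U^T *m U = 1%:M /\ A = U *m diag_mx d *m U^T.
Proof.
elim: n A => [|n IHn] A Asym.
  by exists 1%:M, 0; split; [rewrite [LHS]flatmx0 [RHS]flatmx0|rewrite [LHS]flatmx0 [RHS]flatmx0].
have [a /eigenvalueP [v vA vn0]] := sym_eigen Asym.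
have vv0 : dot v^T v^T != 0 by rewrite dot_eq0 trmx_eq0.
pose u := (Num.sqrt (dot v^T v^T))^-1 *: v^T.
have u1 : dot u u = 1.
  rewrite dotZl dotZr mulrA -invfM -expr2 sqr_sqrtr ?dot_ge0 // mulVf //.
have Au : A *m u = a *: u.
  by rewrite -scalemxAr -[A]Asym -trmx_mul vA linearZ /= !scalerA mulrC.
have [H [HT HH He]] := householder u1.
have [B Bdef] : {B | B = H *m A *m H} by exists (H *m A *m H).
have BT : B^T = B by rewrite Bdef !trmx_mul HT Asym mulmxA.
have Be : B *m delta_mx 0 0 = a *: delta_mx 0 (0 : 'I_1).
  by rewrite Bdef -mulmxA He -mulmxA Au -scalemxAr -He mulmxA HH mul1mx.
have B0 i : B i 0 = a * (i == 0)%:R.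
  move/matrixP/(_ i 0): Be; rewrite -colE !mxE eqxx andbT => ->.
  by rewrite eq_sym.
pose A1 : 'M[R]_n := drsubmx (B : 'M[R]_(1 + n)).
have A1T : A1^T = A1 by rewrite /A1 trmx_drsub BT.
have [V [d [VV A1E]]] := IHn A1 A1T.
have l0 (j : 'I_1) : lshift n j = (0 : 'I_n.+1) by rewrite ord1; apply/val_inj.
have B00 : B 0 0 = a by rewrite B0 eqxx mulr1.
have B0r (j : 'I_n) : B (rshift 1 j : 'I_n.+1) 0 = 0 by rewrite B0 mulr0.
have BE : (B : 'M[R]_(1 + n)) = block_mx a%:M 0 0 A1.
  rewrite -[LHS](@submxK R 1 n 1 n); congr block_mx.
  - by rewrite [LHS]mx11_scalar !mxE l0 B00.
  - apply/matrixP => i j; rewrite !mxE -BT mxE.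
    by rewrite l0; exact: B0r.
  - apply/matrixP => i j; rewrite !mxE.
    by rewrite l0; exact: B0r.
pose W : 'M[R]_(1+n) := block_mx 1%:M 0 0 V.
have WT : W^T = block_mx 1%:M 0 0 V^T.
  by rewrite /W tr_block_mx trmx1 !trmx0.
have WW : W^T *m W = 1%:M.
  rewrite WT /W mulmx_block !(mulmx0, mul0mx, mul1mx, addr0, add0r) VV.
  by rewrite -scalar_mx_block.
have BW : (B : 'M[R]_(1 + n)) = W *m diag_mx (row_mx a%:M d) *m W^T.
  rewrite WT /W diag_mx_row !mulmx_block !(mulmx0, mul0mx, mul1mx, mulmx1, addr0, add0r).
  rewrite BE A1E; congr block_mx.
  by apply/matrixP => i j; rewrite !ord1 !mxE eqxx !mulr1n.
exists (H *m (W : 'M[R]_n.+1)), (row_mx a%:M d); split.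
  by rewrite trmx_mul HT mulmxA -(mulmxA _ H H) HH mulmx1.
have -> : A = H *m B *m H.
  by rewrite Bdef !mulmxA HH mul1mx -mulmxA HH mulmx1.
by rewrite trmx_mul HT BW !mulmxA.
Qed.

End LinearAlgebra.

(** * Functional calculus and the Lipschitz bound for the logarithm *)

Section SpectralCalculus.
Variable R : realType.
Implicit Types (n : nat) (f g : R -> R).

(** The matrix f(A) for A = U diag(d) U^T, with the diagonalization kept as data so that
    independence of its choice never has to be shown. *)
Definition mxfun n (U : 'M[R]_n) (d : 'rV[R]_n) (f : R -> R) : 'M[R]_n :=
  U *m diag_mx (map_mx f d) *m U^T.

Lemma qfE n (A : 'M[R]_n) x : (x^T *m A *m x) 0 0 = qf A x.
Proof. by rewrite /qf /dot mulmxA. Qed.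

Lemma qfD n (A B : 'M[R]_n) x : qf (A + B) x = qf A x + qf B x.
Proof. by rewrite /qf mulmxDl dotDr. Qed.

Lemma qfN n (A : 'M[R]_n) x : qf (- A) x = - qf A x.
Proof. by rewrite /qf mulNmx dotNr. Qed.

Lemma qfB n (A B : 'M[R]_n) x : qf (A - B) x = qf A x - qf B x.
Proof. by rewrite qfD qfN. Qed.

Lemma qfZ n c (A : 'M[R]_n) x : qf (c *: A) x = c * qf A x.
Proof. by rewrite /qf -scalemxAl dotZr. Qed.

Lemma qf_scalar n c (x : 'cV[R]_n) : qf c%:M x = c * dot x x.
Proof. by rewrite /qf mul_scalar_mx dotZr. Qed.

Lemma mxfun_id n (U : 'M[R]_n) (d : 'rV[R]_n) : mxfun U d id = U *m diag_mx d *m U^T.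
Proof. by rewrite /mxfun map_mx_id. Qed.

Lemma mxfun_sym n (U : 'M[R]_n) (d : 'rV[R]_n) f : (mxfun U d f)^T = mxfun U d f.
Proof. by rewrite /mxfun !trmx_mul trmxK tr_diag_mx mulmxA. Qed.

Lemma qf_mxfun n (U : 'M[R]_n) (d : 'rV[R]_n) f x :
  qf (mxfun U d f) x = \sum_i f (d 0 i) * ((U^T *m x) i 0) ^+ 2.
Proof.
rewrite /qf /mxfun -!mulmxA dot_mulmx dotE; apply: eq_bigr => i _.
by rewrite mul_diag_mx !mxE mulrCA -expr2.
Qed.

Lemma sum_sqr_ortho n (U : 'M[R]_n) x : U^T *m U = 1%:M ->
  \sum_i ((U^T *m x) i 0) ^+ 2 = dot x x.
Proof.
move=> UU; transitivity (dot (U^T *m x) (U^T *m x)).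
  by rewrite dotE; apply: eq_bigr => i _; rewrite expr2.
by rewrite dot_ortho // trmxK; apply: orthoV.
Qed.

Lemma mxfunM n (U : 'M[R]_n) (d : 'rV[R]_n) f g : U^T *m U = 1%:M ->
  mxfun U d f *m mxfun U d g = mxfun U d (fun z => f z * g z).
Proof.
move=> UU; rewrite /mxfun !mulmxA -(mulmxA _ U^T U) UU mulmx1 -(mulmxA U).
rewrite mulmx_diag; congr (_ *m diag_mx _ *m _).
by apply/rowP => i; rewrite !mxE.
Qed.

Lemma tr_mxfun n (U : 'M[R]_n) (d : 'rV[R]_n) f : U^T *m U = 1%:M ->
  \tr (mxfun U d f) = \sum_i f (d 0 i).
Proof.
move=> UU; rewrite /mxfun -mulmxA mxtrace_mulC -mulmxA UU mulmx1 mxtrace_diag.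
by apply: eq_bigr => i _; rewrite mxE.
Qed.

Lemma eq_mxfun n (U : 'M[R]_n) (d : 'rV[R]_n) f g : (forall i, f (d 0 i) = g (d 0 i)) ->
  mxfun U d f = mxfun U d g.
Proof.
move=> fg; rewrite /mxfun; congr (_ *m diag_mx _ *m _).
by apply/rowP => i; rewrite !mxE.
Qed.

Lemma trmx_col_ortho n (U : 'M[R]_n) i : U^T *m U = 1%:M ->
  U^T *m col i U = delta_mx i 0.
Proof. by move=> UU; rewrite colE mulmxA UU mul1mx. Qed.

Lemma dot_col_ortho n (U : 'M[R]_n) i : U^T *m U = 1%:M ->
  dot (col i U) (col i U) = 1.
Proof.
by move=> UU; rewrite /dot {2}colE mulmxA tr_col -row_mul UU -colE !mxE eqxx.
Qed.

Lemma mxfun_col n (U : 'M[R]_n) (d : 'rV[R]_n) f i : U^T *m U = 1%:M ->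
  mxfun U d f *m col i U = f (d 0 i) *: col i U.
Proof.
move=> UU; rewrite /mxfun -mulmxA trmx_col_ortho // -mulmxA mul_diag_mx colE.
rewrite scalemxAr; congr (_ *m _); apply/matrixP => k l; rewrite !mxE.
by case: eqP => [->|_] //=; rewrite !mulr0.
Qed.

Lemma qf_col n (U : 'M[R]_n) (d : 'rV[R]_n) f i : U^T *m U = 1%:M ->
  qf (mxfun U d f) (col i U) = f (d 0 i).
Proof. by move=> UU; rewrite /qf mxfun_col // dotZr dot_col_ortho // mulr1. Qed.

Lemma qf_approx n (U : 'M[R]_n) (d : 'rV[R]_n) f g e x : U^T *m U = 1%:M ->
  (forall i, `|f (d 0 i) - g (d 0 i)| <= e) ->
  `|qf (mxfun U d f) x - qf (mxfun U d g) x| <= e * dot x x.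
Proof.
move=> UU fg; rewrite !qf_mxfun -sumrB -(sum_sqr_ortho x UU) mulr_sumr.
apply: le_trans (ler_norm_sum _ _ _) _; apply: ler_sum => i _.
by rewrite -mulrBl normrM [`|_ ^+ 2|]ger0_norm ?sqr_ge0 // ler_wpM2r // sqr_ge0.
Qed.

Lemma qf_mxfun_cst n (U : 'M[R]_n) (d : 'rV[R]_n) c x : U^T *m U = 1%:M ->
  qf (mxfun U d (fun=> c)) x = c * dot x x.
Proof. by move=> UU; rewrite qf_mxfun -mulr_sumr sum_sqr_ortho. Qed.

Lemma qf_mxfun_ge n (U : 'M[R]_n) (d : 'rV[R]_n) f c x : U^T *m U = 1%:M ->
  (forall i, c <= f (d 0 i)) -> c * dot x x <= qf (mxfun U d f) x.
Proof.
move=> UU cf; rewrite -(qf_mxfun_cst d c x UU) !qf_mxfun.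
by apply: ler_sum => i _; rewrite ler_wpM2r // sqr_ge0.
Qed.

(** D is diagonalized and its spectrum compared with the zero function, so testing unit eigenvectors
    is enough. *)
Lemma sym_qf_bound n (D : 'M[R]_n) c : D^T = D ->
  (forall u mu, dot u u = 1 -> D *m u = mu *: u -> `|mu| <= c) ->
  forall x, `|qf D x| <= c * dot x x.
Proof.
move=> DT Dc x; have [W [mu [WW DE]]] := sym_spectral DT.
rewrite DE -mxfun_id -[qf _ x]subr0.
have -> : 0 = qf (mxfun W mu (fun=> 0)) x by rewrite qf_mxfun_cst // mul0r.
apply: qf_approx => // i; rewrite subr0; apply: (Dc (col i W)).
  exact: dot_col_ortho.
by rewrite DE -mxfun_id mxfun_col.
Qed.

(* S^2 - T^2 = S (S - T) + (S - T) T is tested on the eigenvectors of S - T. *)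
Lemma sqr_qf_lipschitz n (S T : 'M[R]_n) s c : S^T = S -> T^T = T -> 0 < s ->
  (forall x, s * dot x x <= qf S x) -> (forall x, s * dot x x <= qf T x) ->
  (forall x, `|qf (S *m S - T *m T) x| <= c * dot x x) ->
  forall x, `|qf (S - T) x| <= c / (2 * s) * dot x x.
Proof.
move=> ST TT s0 Ss Ts ST2; apply: sym_qf_bound.
  by rewrite linearB /= ST TT.
move=> u mu u1 Du; rewrite ler_pdivlMr ?mulr_gt0 //.
have /(_ u) := ST2; rewrite u1 mulr1.
have -> : S *m S - T *m T = S *m (S - T) + (S - T) *m T.
  by rewrite mulmxBr mulmxBl addrA subrK.
have -> : qf (S *m (S - T) + (S - T) *m T) u = mu * (qf S u + qf T u).
  rewrite qfD /qf -!mulmxA Du -scalemxAr dotZr (dot_mulmx (S - T)).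
  by rewrite linearB /= ST TT Du dotZl -mulrDr.
apply: le_trans; rewrite normrM ler_wpM2l //.
have := Ss u; have := Ts u; rewrite u1 => h1 h2.
by apply: le_trans (ler_norm _); lra.
Qed.

(** The lower side is exp z >= 1 + z. The same inequality at -z gives exp z <= 1 / (1 - z), and 1 /
    (1 - z) - 1 - z = z^2 / (1 - z). *)
Lemma expR_approx1 (z : R) : `|z| <= 1 / 2 -> `|expR z - 1 - z| <= 2 * z ^+ 2.
Proof.
move=> hz; have := expR_ge1Dx z; have := expR_ge1Dx (- z).
move: hz; rewrite ler_norml => /andP[z1 z2] h1 h2.
have e0 := expR_gt0 z.
have : expR z * (1 - z) <= 1.
  by rewrite -[leRHS](expRxMexpNx_1 z) ler_pM2l.
move=> h3; rewrite ger0_norm; last lra.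
nra.
Qed.

Lemma expR_le1D2 (z : R) : `|z| <= 1 / 2 -> expR z <= 1 + 2 * `|z|.
Proof.
move=> hz; have := expR_approx1 hz; rewrite ler_norml => /andP[_ h].
have := ler_norm z; have : z ^+ 2 = `|z| ^+ 2 by rewrite real_normK // num_real.
have := normr_ge0 z; move: (`|z|) hz h => w hw h w0 zw zw'; nra.
Qed.

(** The function applied is the 2^k-th root. Passing from level k to k + 1 divides the constant by 2
    s with s = alpha^(2^-(k+1)); after k steps these divisors multiply to 2^k alpha^(1 - 2^-k). *)
Lemma root_qf_lipschitz n (U V : 'M[R]_n) (a b : 'rV[R]_n) alpha c k :
  U^T *m U = 1%:M -> V^T *m V = 1%:M -> 0 < alpha ->
  (forall i, alpha <= a 0 i) -> (forall i, alpha <= b 0 i) ->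
  (forall x, `|qf (mxfun U a id - mxfun V b id) x| <= c * dot x x) ->
  forall x, `|qf (mxfun U a (fun z => expR (ln z / 2 ^+ k))
                - mxfun V b (fun z => expR (ln z / 2 ^+ k))) x|
     <= c / 2 ^+ k * expR (- ln alpha * (1 - (2 ^+ k)^-1)) * dot x x.
Proof.
move=> UU VV al0 aa ab; elim: k c => [|k IHk] c AB.
  have e (W : 'M[R]_n) (d : 'rV[R]_n) : (forall i, alpha <= d 0 i) ->
      mxfun W d (fun z => expR (ln z / 2 ^+ 0)) = mxfun W d id.
    move=> dal; apply: eq_mxfun => i.
    by rewrite expr0 divr1 lnK // posrE (lt_le_trans al0).
  move=> x; rewrite !e // expr0 divr1 invr1 subrr mulr0 expR0 mulr1; exact: AB.
have two0 : (2 : R) ^+ k.+1 != 0 by rewrite expf_neq0.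
have two0' : (2 : R) ^+ k != 0 by rewrite expf_neq0.
have s0 : 0 < expR (ln alpha / 2 ^+ k.+1) by rewrite expR_gt0.
have ge (W : 'M[R]_n) (d : 'rV[R]_n) : W^T *m W = 1%:M -> (forall i, alpha <= d 0 i) ->
   forall x, expR (ln alpha / 2 ^+ k.+1) * dot x x <=
     qf (mxfun W d (fun z => expR (ln z / 2 ^+ k.+1))) x.
  move=> WW dal x; apply: qf_mxfun_ge => // i.
  rewrite ler_expR ler_wpM2r // ?invr_ge0 ?exprn_ge0 //.
  by rewrite ler_ln ?posrE // (lt_le_trans al0).
have sq (W : 'M[R]_n) (d : 'rV[R]_n) : W^T *m W = 1%:M ->
  mxfun W d (fun z => expR (ln z / 2 ^+ k.+1)) *m mxfun W d (fun z => expR (ln z / 2 ^+ k.+1))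
  = mxfun W d (fun z => expR (ln z / 2 ^+ k)).
  move=> WW; rewrite mxfunM //; apply: eq_mxfun => i; rewrite -expRD; congr expR.
  by rewrite exprS; field.
have /(_ (c / 2 ^+ k * expR (- ln alpha * (1 - (2 ^+ k)^-1)))) :=
  sqr_qf_lipschitz (mxfun_sym _ _ _) (mxfun_sym _ _ _) s0 (ge U a UU aa) (ge V b VV ab).
rewrite !sq // => /(_ (IHk _ AB)) h x; apply: le_trans (h x) _.
rewrite le_eqVlt; apply/orP; left; apply/eqP; congr (_ * _).
have -> : expR (- ln alpha * (1 - (2 ^+ k)^-1)) =
    expR (- ln alpha * (1 - (2 ^+ k.+1)^-1)) * expR (ln alpha / 2 ^+ k.+1).
  by rewrite -expRD; congr expR; rewrite exprS; field.
by rewrite exprS; field; rewrite two0' gt_eqF ?expR_gt0.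
Qed.

(** Stands in for a limit in k: if X > Y, some large k has |C| / (X - Y) < k < 2^k. *)
Lemma ler_of_geometric (X Y C : R) k0 :
  (forall k, (k0 <= k)%N -> X <= Y + C / 2 ^+ k) -> X <= Y.
Proof.
move=> H; rewrite leNgt; apply/negP => YX.
pose k := maxn k0 (Num.trunc (`|C| / (X - Y))).+1.
have k1 : `|C| / (X - Y) < k%:R.
  apply: lt_le_trans (truncnS_gt _) _; by rewrite ler_nat leq_maxr.
have k2 : k%:R < 2 ^+ k :> R by rewrite -natrX ltr_nat ltn_expl.
have := H k (leq_maxl _ _); rewrite -lerBlDl ler_pdivlMr ?exprn_gt0 // => h.
have : `|C| < (X - Y) * k%:R by rewrite mulrC -ltr_pdivrMr // subr_gt0.
have := ler_norm C; have : (X - Y) * k%:R < (X - Y) * 2 ^+ k by rewrite ltr_pM2l // subr_gt0.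
lra.
Qed.

Theorem log_qf_lipschitz n (U V : 'M[R]_n) (a b : 'rV[R]_n) alpha c :
  U^T *m U = 1%:M -> V^T *m V = 1%:M -> 0 < alpha ->
  (forall i, alpha <= a 0 i) -> (forall i, alpha <= b 0 i) -> 0 <= c ->
  (forall x, `|qf (mxfun U a id - mxfun V b id) x| <= c * dot x x) ->
  forall x, `|qf (mxfun U a (@ln R) - mxfun V b (@ln R)) x| <= c / alpha * dot x x.
Proof.
move=> UU VV al0 aa ab c0 AB x.
(* One bound for the logarithms of all eigenvalues and of alpha; for k >= [k0] it keeps every
   exponent ln z / 2^k within 1/2 of zero. *)
pose M := `|ln alpha| + (\sum_i `|ln (a 0 i)| + \sum_i `|ln (b 0 i)|).
have M0 : 0 <= M by rewrite !addr_ge0 // sumr_ge0.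
have Mal : `|ln alpha| <= M by rewrite lerDl addr_ge0 // sumr_ge0.
have Ma i : `|ln (a 0 i)| <= M.
  rewrite /M (bigD1 i) //= addrCA -addrA lerDl !addr_ge0 // sumr_ge0 //.
have Mb i : `|ln (b 0 i)| <= M.
  rewrite /M; apply: ler_wpDl => //; apply: ler_wpDl; first exact: sumr_ge0.
  by rewrite (bigD1 i) //= lerDl sumr_ge0.
have X0 := dot_ge0 x.
pose k0 := (Num.trunc (2 * M)).+1.
(* Replacing ln z by 2^k (z^(2^-k) - 1) costs 2 M^2 / 2^k for each of the two matrices; alpha^(2^-k)
   <= 1 + 2 M / 2^k accounts for the term 2 c M / alpha. *)
apply: (@ler_of_geometric _ _ ((4 * M ^+ 2 + 2 * c * M / alpha) * dot x x) k0) => k kk0.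
have kM : M / 2 ^+ k <= 1 / 2.
  rewrite ler_pdivrMr ?exprn_gt0 // mulrAC mul1r ler_pdivlMr // mulrC.
  apply: le_trans (ltW (truncnS_gt _)) _.
  by rewrite -natrX ler_nat (leq_trans kk0) // ltnW // ltn_expl.
set h := (2 ^+ k)^-1 : R.
have h0 : 0 < h by rewrite invr_gt0 exprn_gt0.
have hk : 2 ^+ k * h = 1 by rewrite mulfV // expf_neq0.
have lnh z : `|z| <= M -> `|z * h| <= M * h.
  by move=> zM; rewrite normrM (gtr0_norm h0) ler_wpM2r // ltW.
have app z : `|z| <= M -> `|z - 2 ^+ k * (expR (z * h) - 1)| <= 2 * M ^+ 2 * h.
  move=> zM; have := expR_approx1 (le_trans (lnh _ zM) kM).
  have -> : z - 2 ^+ k * (expR (z * h) - 1) = - (2 ^+ k * (expR (z * h) - 1 - z * h)).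
    by rewrite -[X in X - _ = _](mulr1 z) -[X in z * X - _]hk; ring.
  rewrite normrN normrM ger0_norm ?exprn_ge0 // => h1.
  have : 2 ^+ k * `|expR (z * h) - 1 - z * h| <= 2 ^+ k * (2 * (z * h) ^+ 2).
    by rewrite ler_wpM2l // exprn_ge0.
  move/le_trans; apply.
  have -> : 2 ^+ k * (2 * (z * h) ^+ 2) = 2 * z ^+ 2 * h * (2 ^+ k * h) by ring.
  rewrite hk mulr1 ler_wpM2r ?(ltW h0) // ler_wpM2l //.
  by rewrite -[z ^+ 2]real_normK ?num_real // lerXn2r ?nnegrE.
have qS (W : 'M[R]_n) (d : 'rV[R]_n) : W^T *m W = 1%:M ->
    qf (mxfun W d (fun z => 2 ^+ k * (expR (ln z * h) - 1))) x
    = 2 ^+ k * (qf (mxfun W d (fun z => expR (ln z * h))) x - dot x x).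
  move=> WW; rewrite !qf_mxfun -(sum_sqr_ortho x WW) -sumrB mulr_sumr.
  by apply: eq_bigr => i _; ring.
have hA := qf_approx (f := @ln R) (g := fun z => 2 ^+ k * (expR (ln z * h) - 1))
  x UU (fun i => app _ (Ma i)).
have hB := qf_approx (f := @ln R) (g := fun z => 2 ^+ k * (expR (ln z * h) - 1))
  x VV (fun i => app _ (Mb i)).
have := root_qf_lipschitz k UU VV al0 aa ab AB x.
rewrite -/h qfB => hAB.
have {hAB} : 2 ^+ k * `|qf (mxfun U a (fun z => expR (ln z * h))) x -
  qf (mxfun V b (fun z => expR (ln z * h))) x| <= c / alpha * (1 + 2 * M * h) * dot x x.
  have : 2 ^+ k * `|qf (mxfun U a (fun z => expR (ln z * h))) x -
  qf (mxfun V b (fun z => expR (ln z * h))) x| <= 2 ^+ k * (c * h * expR (- ln alpha * (1 - h)) * dot x x).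
    by rewrite ler_wpM2l // exprn_ge0.
  move/le_trans; apply.
  set E := expR _; have -> : 2 ^+ k * (c * h * E * dot x x) = (2 ^+ k * h) * (c * E) * dot x x by ring.
  rewrite hk mul1r ler_wpM2r // -mulrA ler_wpM2l // /E.
  rewrite mulrBr mulr1 expRD expRN lnK ?posrE // ler_wpM2l ?invr_ge0 ?(ltW al0) //.
  rewrite mulNr opprK; apply: le_trans (expR_le1D2 (le_trans (lnh _ Mal) kM)) _.
  by rewrite lerD2l -mulrA ler_wpM2l // lnh.
move: hA hB; rewrite !qS // qfB.
set LA := qf (mxfun U a _) x; set LB := qf (mxfun V b (@ln R)) x.
set SA := qf _ x; set SB := qf _ x => hA hB hAB.
have -> : LA - LB = (LA - 2 ^+ k * (SA - dot x x)) - (LB - 2 ^+ k * (SB - dot x x))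
   + 2 ^+ k * (SA - SB) by ring.
apply: le_trans (ler_normD _ _) _; rewrite [X in _ + X]normrM (ger0_norm (exprn_ge0 _ _)) //.
apply: le_trans (lerD (ler_normB _ _) hAB) _.
apply: le_trans (lerD (lerD hA hB) (lexx _)) _.
rewrite le_eqVlt; apply/orP; left; apply/eqP; field; exact: lt0r_neq0.
Qed.

End SpectralCalculus.

(** * Lanczos quadrature *)

Section SpectralPolynomials.
Variable R : realType.

(** [matlog] selects a diagonalization by choice; this recovers it. Its eigenvalues are located by
    evaluating the form at the columns of U. *)
Lemma matlogP n (A : 'M[R]_n) (alpha beta : R) : A^T = A -> 0 < alpha ->
  (forall x, alpha * dot x x <= qf A x) -> (forall x, qf A x <= beta * dot x x) ->
  exists (U : 'M[R]_n) (d : 'rV[R]_n),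
    [/\ U^T *m U = 1%:M, A = mxfun U d id, matlog A = mxfun U d (@ln R)
      & forall i, alpha <= d 0 i <= beta].
Proof.
move=> AT al0 Aal Abe.
have bnd (U : 'M[R]_n) (d : 'rV[R]_n) : U^T *m U = 1%:M -> A = U *m diag_mx d *m U^T ->
    forall i, alpha <= d 0 i <= beta.
  move=> UU; rewrite -mxfun_id => AE i; have := Aal (col i U); have := Abe (col i U).
  by rewrite AE qf_col // dot_col_ortho // !mulr1 => -> ->.
have ex : exists U d, spd_decomp A U d.
  have [U [d [UU AE]]] := sym_spectral AT; exists U, d; split; [by []|split=> // i].
  by have /andP[/(lt_le_trans al0)] := bnd _ _ UU AE i.
rewrite /matlog; case: pselect => // h; case: (cid h) => U hU; case: (cid hU) => d [UU [AE dp]].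
by exists U, d; split => //; [rewrite mxfun_id | exact: bnd AE].
Qed.

Lemma iter_mulmx_mxfun n (U : 'M[R]_n) (d : 'rV[R]_n) k (x : 'cV[R]_n) : U^T *m U = 1%:M ->
  iter k (mulmx (mxfun U d id)) x = mxfun U d (fun z => z ^+ k) *m x.
Proof.
move=> UU; elim: k => [|k IHk] /=.
  have -> : mxfun U d (fun z => z ^+ 0) = 1%:M; last by rewrite mul1mx.
  rewrite /mxfun (_ : map_mx _ d = const_mx 1) ?diag_const_mx ?mulmx1 ?orthoV //.
  by apply/rowP => i; rewrite !mxE.
by rewrite IHk mulmxA mxfunM //; congr (_ *m _); apply: eq_mxfun => i; rewrite exprS.
Qed.

(** Reduces p(A) to the moments of A at x, the quantities that the Lanczos process preserves. *)
Lemma qf_horner n (U : 'M[R]_n) (d : 'rV[R]_n) (p : {poly R}) (x : 'cV[R]_n) : U^T *m U = 1%:M ->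
  qf (mxfun U d (fun z => p.[z])) x
  = \sum_(k < size p) p`_k * dot x (iter k (mulmx (mxfun U d id)) x).
Proof.
move=> UU; under [RHS]eq_bigr => k _.
  rewrite iter_mulmx_mxfun // -/(qf _ x) qf_mxfun mulr_sumr; over.
rewrite exchange_big qf_mxfun /=; apply: eq_bigr => i _.
rewrite horner_coef mulr_suml; apply: eq_bigr => k _.
rewrite -mulrA; reflexivity.
Qed.

Lemma col_mulmx a b c (M : 'M[R]_(a, b)) (B : 'M[R]_(b, c)) j :
  col j (M *m B) = M *m col j B.
Proof. by rewrite !colE mulmxA. Qed.

Lemma frobnorm_eq0 n (x : 'cV[R]_n) : (frobnorm x == 0) = (x == 0).
Proof. by rewrite -sqrf_eq0 frobnorm_dot dot_eq0. Qed.

End SpectralPolynomials.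

(** * Lanczos vectors and coefficients as infinite sequences *)

Section LanczosSequences.
Variable R : realType.
Variables (m : nat) (A : 'M[R]_m) (q0 : 'cV[R]_m).

(* The Lanczos vectors lq and coefficients la, lb, continued past a breakdown,
   where the junk value 0^-1 = 0 makes all later vectors vanish. *)
Definition lstep (s : 'cV[R]_m * 'cV[R]_m * R) :=
  let v := A *m s.1.2 - s.2 *: s.1.1 in
  let v' := v - dot s.1.2 v *: s.1.2 in
  (s.1.2, (frobnorm v')^-1 *: v', frobnorm v').

Definition lst k := iter k lstep (0, q0, 0).
Definition lq k := (lst k).1.2.
(** The term beta_{k-1} q_{k-1} of the recurrence, zero for k = 0. *)
Definition lprev k := (lst k).2 *: (lst k).1.1.
Definition la k := dot (lq k) (A *m lq k - lprev k).
Definition lres k := A *m lq k - lprev k - la k *: lq k.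
Definition lb k := frobnorm (lres k).

(** The arbitrary starting index j lets the induction on the number of steps go through. The last
    clause separates a full run from a breakdown; either one later yields enough matching
    moments. *)
Lemma lanczos_auxP k j (r := lanczos_aux A k.+1 (lst j).1.1 (lst j).1.2 (lst j).2) :
  [/\ (0 < size r.1)%N,
      forall i, (i < size r.1)%N -> r.1`_i = la (j + i),
      forall i, (i.+1 < size r.1)%N -> r.2`_i = lb (j + i) /\ lb (j + i) != 0
    & size r.1 = k.+1 \/ lb (j + (size r.1).-1) = 0].
Proof.
rewrite {}/r; elim: k j => [|k IHk] j.
  rewrite /=; split => //; [by case=> // _; rewrite addn0 | by left].
have -> : lanczos_aux A k.+2 (lst j).1.1 (lst j).1.2 (lst j).2 =
  if lb j == 0 then ([:: la j], [::])
  else let ab := lanczos_aux A k.+1 (lst j.+1).1.1 (lst j.+1).1.2 (lst j.+1).2 in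
         (la j :: ab.1, lb j :: ab.2) by [].
have [b0|b0] := eqVneq (lb j) 0.
  split => //=; [by case=> // _; rewrite addn0|by right; rewrite addn0].
have [h1 h2 h3 h4] := IHk j.+1; split => //=.
- by case=> [|i] /= hi; rewrite ?addn0 // addnS -addSn h2.
- by case=> [|i] /= hi; rewrite ?addn0 // addnS -addSn; apply: h3.
- case: h4 => [->|h4]; [by left|right].
  by move: h4; rewrite addSnnS prednK.
Qed.

End LanczosSequences.

(* The sequences of LanczosSequences, seen only through their recurrences:
   unification would otherwise unfold the iterates. *)
Section ThreeTermRecurrence.
Variable R : realType.
Variables (m : nat) (A : 'M[R]_m) (lq lprev lres : nat -> 'cV[R]_m) (la lb : nat -> R).
Hypothesis lprev0 : lprev 0 = 0.
Hypothesis lprevS : forall k, lprev k.+1 = lb k *: lq k.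
Hypothesis laE : forall k, la k = dot (lq k) (A *m lq k - lprev k).
Hypothesis lres_def : forall k, lres k = A *m lq k - lprev k - la k *: lq k.
Hypothesis lbE : forall k, lb k = frobnorm (lres k).
Hypothesis lqS : forall k, lq k.+1 = (lb k)^-1 *: lres k.
Hypothesis AT : A^T = A.
Hypothesis q01 : dot (lq 0) (lq 0) = 1.

(** Valid at a breakdown as well: [lb k] is the norm of [lres k], so both sides vanish. *)
Lemma lresE k : lres k = lb k *: lq k.+1.
Proof.
rewrite lqS scalerA; have [b0|b0] := eqVneq (lb k) 0.
  by rewrite b0 mul0r scale0r; apply/eqP; rewrite -frobnorm_eq0 -lbE b0.
by rewrite mulfV // scale1r.
Qed.

Lemma mulmx_lq k : A *m lq k = lprev k + la k *: lq k + lres k.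
Proof. by rewrite lres_def -addrA subrKC subrKC. Qed.

(** Against q_j the residual vanishes by the choice of [la]. Against an earlier q_i, symmetry moves
    A onto q_i, whose image is spanned by q_{i-1}, q_i and q_{i+1}; this meets q_j only for i + 1 =
    j, where the subtracted [lprev] cancels it. *)
Lemma lanczos_res_ortho j :
  (forall i l, (i <= j)%N -> (l <= j)%N -> dot (lq i) (lq l) = (i == l)%:R) ->
  forall i, (i <= j)%N -> dot (lq i) (lres j) = 0.
Proof.
move=> O i; rewrite leq_eqVlt => /orP[/eqP -> | ij].
  by rewrite lres_def dotBr dotZr O // eqxx mulr1 laE subrr.
case: j O ij => // j O; rewrite ltnS => ij.
rewrite lres_def !dotBr dotZr O ?(leq_trans ij) // ltn_eqF ?ltnS // mulr0 subr0.
rewrite dot_mulmx AT mulmx_lq lresE lprevS dotC !dotDr !dotZr.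
have -> : dot (lq j.+1) (lprev i) = 0.
  case: i ij => [|i] ij; first by rewrite lprev0 dot0r.
  by rewrite lprevS dotZr O ?gtn_eqF ?mulr0 //; lia.
rewrite !O ?(leq_trans ij) // gtn_eqF // mulr0 add0r add0r eqSS.
rewrite [i == j]eq_sym; case: eqP => [->|_]; first by rewrite subrr.
by rewrite !mulr0 subrr.
Qed.

Lemma lanczos_ortho j : (forall i, (i < j)%N -> lb i != 0) ->
  forall i l, (i <= j)%N -> (l <= j)%N -> dot (lq i) (lq l) = (i == l)%:R.
Proof.
elim: j => [_ [|//] [|//] _ _|j IHj b0]; first by rewrite q01.
have O := IHj (fun i hi => b0 i (leqW hi)).
have res := lanczos_res_ortho O.
have qS i : (i <= j)%N -> dot (lq i) (lq j.+1) = 0.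
  by move=> ij; rewrite lqS dotZr res // mulr0.
have qq : dot (lq j.+1) (lq j.+1) = 1.
  by rewrite lqS dotZr dotZl -frobnorm_dot -lbE expr2 mulKf ?mulVf ?b0.
move=> i l; rewrite leq_eqVlt => /orP[/eqP -> | ij].
  rewrite leq_eqVlt => /orP[/eqP -> | lj]; first by rewrite eqxx.
  by rewrite dotC qS // gtn_eqF.
rewrite leq_eqVlt => /orP[/eqP -> | lj]; first by rewrite qS // ltn_eqF.
exact: O.
Qed.

Variables (sa sb : seq R).
Let n := size sa.
Hypothesis n_gt0 : (0 < n)%N.
Hypothesis sa_la : forall i, (i < n)%N -> sa`_i = la i.
Hypothesis sb_lb : forall i, (i.+1 < n)%N -> sb`_i = lb i /\ lb i != 0.

Let T : 'M[R]_n := tridiag sa sb.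
Let Q : 'M[R]_(m, n) := \matrix_(i, j) lq j i 0.

Lemma lanczos_ortho_lt i l : (i < n)%N -> (l < n)%N -> dot (lq i) (lq l) = (i == l)%:R.
Proof.
move=> hi hl; have nE := prednK n_gt0.
apply: (@lanczos_ortho n.-1) => [k hk| |]; last 2 first.
- by rewrite -ltnS nE.
- by rewrite -ltnS nE.
by apply: (sb_lb _).2; rewrite -nE ltnS.
Qed.

Lemma lanczos_res_ortho_lt i l : (i <= l)%N -> (l < n)%N -> dot (lq i) (lres l) = 0.
Proof.
move=> il ln; apply: lanczos_res_ortho il => i1 l1 h1 h2.
by apply: lanczos_ortho_lt; apply: leq_ltn_trans ln.
Qed.

Lemma col_lanczos_basis (j : 'I_n) : col j Q = lq j.
Proof. by apply/colP => i; rewrite !mxE. Qed.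

Lemma lanczos_basis_ortho : Q^T *m Q = 1%:M.
Proof.
apply/matrixP => i j; rewrite [RHS]mxE -val_eqE /= -lanczos_ortho_lt //.
by rewrite dotE mxE; apply: eq_bigr => k _; rewrite !mxE.
Qed.

Lemma dot_lq_mul i j : (j <= i)%N -> (i < n)%N ->
  dot (lq i) (A *m lq j) = if i == j then la i else if j.+1 == i then lb j else 0.
Proof.
move=> ji ni; rewrite mulmx_lq !dotDr dotZr lanczos_ortho_lt ?(leq_ltn_trans ji) //.
have -> : dot (lq i) (lprev j) = 0.
  case: j ji => [|j] ji; first by rewrite lprev0 dot0r.
  by rewrite lprevS dotZr lanczos_ortho_lt ?gtn_eqF ?mulr0 //; lia.
have [->|ij] := eqVneq i j.
  rewrite lanczos_res_ortho_lt ?(leq_ltn_trans ji) //.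
  by rewrite mulr1 add0r addr0.
rewrite mulr0 !add0r lresE dotZr lanczos_ortho_lt //; last first.
  by apply: leq_ltn_trans ni; rewrite ltn_neqAle eq_sym ij.
by rewrite eq_sym; case: eqP => _; rewrite ?mulr1 ?mulr0.
Qed.

Lemma tridiag_lanczos : T = Q^T *m A *m Q.
Proof.
apply/matrixP => i j; have -> : (Q^T *m A *m Q) i j = dot (lq i) (A *m lq j).
  rewrite -!col_lanczos_basis -col_mulmx dotE -mulmxA mxE; apply: eq_bigr => k _.
  by rewrite [X in X * _ = _]mxE [X in _ = X * _]mxE [X in _ = _ * X]mxE.
rewrite mxE -val_eqE /=; have [ji|ij] := leqP j i.
  rewrite dot_lq_mul //; case: eqP => [_|/eqP ne]; first exact: sa_la.
  rewrite gtn_eqF ?ltnS // ; case: eqP => [ji1|//].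
  by apply: (sb_lb _).1; rewrite ji1.
rewrite dot_mulmx AT dotC dot_lq_mul ?(ltnW ij) // (ltn_eqF ij) (gtn_eqF ij).
rewrite (_ : (j.+1 == i :> nat) = false); last by lia.
have [ij1|//] := eqVneq i.+1 (j : nat).
have [sE _] : sb`_i = lb i /\ lb i != 0 by apply: sb_lb; rewrite ij1.
by rewrite sE.
Qed.

Lemma qf_tridiag y : qf T y = qf A (Q *m y).
Proof. by rewrite /qf tridiag_lanczos -!mulmxA dot_mulmx trmxK. Qed.

Lemma tridiag_sym : T^T = T.
Proof. by rewrite tridiag_lanczos !trmx_mul trmxK AT mulmxA. Qed.

Lemma mulmx_lanczos_basis (y : 'cV[R]_n) :
  (forall k : 'I_n, y k 0 != 0 -> (k.+1 < n)%N \/ lb k = 0) ->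
  A *m (Q *m y) = Q *m (T *m y).
Proof.
move=> Hy; rewrite tridiag_lanczos !mulmxA.
(* Q Q^T is the projection onto the span of the Lanczos vectors. *)
have PQ i : (i < n)%N -> Q *m Q^T *m lq i = lq i.
  move=> ni; rewrite -(col_lanczos_basis (Ordinal ni)) colE !mulmxA.
  by rewrite -(mulmxA Q) lanczos_basis_ortho mulmx1.
have colsum (M : 'M[R]_(m, n)) : M *m y = \sum_k y k 0 *: col k M.
  by apply/colP => i; rewrite mxE summxE; apply: eq_bigr => k _; rewrite !mxE mulrC.
rewrite !colsum; apply: eq_bigr => k _; have [->|yk] := eqVneq (y k 0) 0; first by rewrite !scale0r.
congr (_ *: _); rewrite !col_mulmx col_lanczos_basis -(mulmxA _ A) mulmx_lq !mulmxDr -!scalemxAr PQ //.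
congr (_ + _ + _).
  case: (nat_of_ord k) (ltn_ord k) => [|k'] hk; first by rewrite lprev0 mulmx0.
  by rewrite lprevS -scalemxAr PQ // ltnW.
rewrite lresE -scalemxAr; have [/PQ ->//|->] := Hy k yk; by rewrite !scale0r.
Qed.

(** A tridiagonal matrix enlarges the support of a vector by at most one index, so T^i e_1 cannot
    touch the last coordinate before i = n - 1. Until then, or always after a breakdown,
    [mulmx_lanczos_basis] carries A over to T. *)
Lemma lanczos_krylov i : (i < n)%N \/ lb n.-1 = 0 ->
  iter i (mulmx A) (lq 0) = Q *m iter i (mulmx T) (e1 R n) /\
  (forall k : 'I_n, (i < k)%N -> iter i (mulmx T) (e1 R n) k 0 = 0).
Proof.
elim: i => [|i IHi] hi.
  split => [/=|k k0]; last by rewrite /= mxE gtn_eqF.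
  have -> : e1 R n = delta_mx (Ordinal n_gt0) 0.
    by apply/colP => k; rewrite !mxE eqxx andbT -val_eqE.
  by rewrite -colE col_lanczos_basis.
have [|E S] := IHi; first by case: hi => [/ltnW|]; [left|right].
rewrite !iterS E; split.
  apply: mulmx_lanczos_basis => k yk.
  case: hi => hi; last first.
    have [kn|kn] := ltnP k.+1 n; [by left|right].
    by have -> : nat_of_ord k = n.-1 by have := prednK n_gt0; have := ltn_ord k; lia.
  left; apply: leq_ltn_trans hi; rewrite ltnS leqNgt; apply: contra yk => ik.
  by rewrite S.
move=> k ik; rewrite mxE big1 // => l _; have [il|li] := ltnP i l.
  by rewrite S // mulr0.
have lk : (l.+1 < k)%N by apply: leq_ltn_trans ik; rewrite ltnS.
rewrite mxE -val_eqE /= gtn_eqF ?(ltnW lk) // ?(@gtn_eqF l) //.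
  by rewrite ltn_eqF // mul0r.
by rewrite ltnS ltnW // ltnW.
Qed.

(** Half of the k factors are moved to the other side of the product, so only Krylov vectors up to
    index k / 2 occur; this doubles the admissible degree, as in Gauss quadrature. For odd k the
    remaining factor is absorbed by T = Q^T A Q. *)
Lemma lanczos_moment k : (k < n.*2)%N \/ lb n.-1 = 0 ->
  dot (lq 0) (iter k (mulmx A) (lq 0)) = dot (e1 R n) (iter k (mulmx T) (e1 R n)).
Proof.
move=> hk.
have split_iter d (B : 'M[R]_d) x i j : B^T = B ->
    dot x (iter (i + j) (mulmx B) x) = dot (iter i (mulmx B) x) (iter j (mulmx B) x).
  move=> BT; rewrite iterD; elim: i (iter j _ x) => [//|i IHi] y.
  by rewrite iterSr IHi iterS dot_mulmx BT.
have hi : (k./2 < n)%N \/ lb n.-1 = 0.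
  by case: hk => [hk|]; [left; rewrite ltn_half_double|right].
have [E _] := lanczos_krylov hi.
rewrite -(odd_double_half k) -addnn addnCA.
rewrite !split_iter ?tridiag_sym // !iterD E; case: (odd k) => /=; last first.
  by rewrite dot_ortho // lanczos_basis_ortho.
by rewrite -[RHS]/(qf T _) qf_tridiag.
Qed.

End ThreeTermRecurrence.

(** By the matching moments p contributes equally to both terms. What remains is the replacement of
    ln by p, once for A and once for T, whence the factor 2; as a compression of A, T has its
    spectrum in the same interval. *)
Lemma lanczos_quad_error (R : realType) m (A : 'M[R]_m) K (w : 'cV[R]_m)
    (alpha beta e : R) (p : {poly R}) :
  A^T = A -> 0 < alpha ->
  (forall x, alpha * dot x x <= qf A x) -> (forall x, qf A x <= beta * dot x x) ->
  w != 0 -> (0 < K)%N -> (size p <= K.*2)%N ->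
  (forall z, alpha <= z <= beta -> `|ln z - p.[z]| <= e) ->
  `|lanczos_quad A K w - qf (matlog A) w| <= 2 * e * dot w w.
Proof.
move=> AT al0 Aal Abe w0; case: K => // K _ sp pe.
have fw0 : frobnorm w != 0 by rewrite frobnorm_eq0.
set q0 := (frobnorm w)^-1 *: w.
have q01 : dot q0 q0 = 1.
  by rewrite dotZl dotZr -frobnorm_dot expr2 mulKf // mulVf.
rewrite /lanczos_quad /lanczos -/q0.
have : exists2 r, r = lanczos_aux A K.+1 0 q0 0 &
  [/\ (0 < size r.1)%N,
      forall i, (i < size r.1)%N -> r.1`_i = la A q0 i,
      forall i, (i.+1 < size r.1)%N -> r.2`_i = lb A q0 i /\ lb A q0 i != 0
    & size r.1 = K.+1 \/ lb A q0 (size r.1).-1 = 0].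
  exists (lanczos_aux A K.+1 0 q0 0) => //; exact: (lanczos_auxP A q0 K 0).
case=> [[sa sb]] <- /= [n0 hsa hsb hn]; rewrite qfE.
have l0 : lprev A q0 0 = 0 by rewrite /lprev scale0r.
have TTR := @tridiag_sym R m A (lq A q0) (lprev A q0) (lres A q0) (la A q0) (lb A q0)
  l0 (fun=> erefl) (fun=> erefl) (fun=> erefl) (fun=> erefl) (fun=> erefl) AT q01 sa sb n0 hsa hsb.
have qfT := @qf_tridiag R m A (lq A q0) (lprev A q0) (lres A q0) (la A q0) (lb A q0)
  l0 (fun=> erefl) (fun=> erefl) (fun=> erefl) (fun=> erefl) (fun=> erefl) AT q01 sa sb n0 hsa hsb.
have QQ := @lanczos_basis_ortho R m A (lq A q0) (lprev A q0) (lres A q0) (la A q0) (lb A q0)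
  l0 (fun=> erefl) (fun=> erefl) (fun=> erefl) (fun=> erefl) (fun=> erefl) AT q01 sa sb n0 hsb.
have mom := @lanczos_moment R m A (lq A q0) (lprev A q0) (lres A q0) (la A q0) (lb A q0)
  l0 (fun=> erefl) (fun=> erefl) (fun=> erefl) (fun=> erefl) (fun=> erefl) AT q01 sa sb n0 hsa hsb.
set T := tridiag sa sb in TTR qfT mom *.
have [U [d [UU AE logA dbd]]] := matlogP AT al0 Aal Abe.
have Tal x : alpha * dot x x <= qf T x by rewrite qfT -(dot_ortho x x QQ); exact: Aal.
have Tbe x : qf T x <= beta * dot x x by rewrite qfT -(dot_ortho x x QQ); exact: Abe.
have [V [f [VV TE logT fbd]]] := matlogP TTR al0 Tal Tbe.
have ee : dot (e1 R (size sa)) (e1 R (size sa)) = 1.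
  by have := mom 0%N (or_introl _); rewrite /= => <- //; rewrite double_gt0.
rewrite logA logT.
have appA := qf_approx (f := @ln R) (g := fun z => p.[z]) w UU (fun i => pe _ (dbd i)).
have appT := qf_approx (f := @ln R) (g := fun z => p.[z]) (e1 R (size sa)) VV (fun i => pe _ (fbd i)).
rewrite ee mulr1 in appT.
have wq : w = frobnorm w *: q0 by rewrite scalerA mulfV // scale1r.
have pq : qf (mxfun U d (fun z => p.[z])) w
     = frobnorm w ^+ 2 * qf (mxfun V f (fun z => p.[z])) (e1 R (size sa)).
  rewrite !qf_horner // -AE -TE mulr_sumr; apply: eq_bigr => k _.
  rewrite mulrCA; congr (_ * _).
  have -> : iter k (mulmx A) w = frobnorm w *: iter k (mulmx A) q0.
    rewrite [in LHS]wq; elim: (nat_of_ord k) => //= j ->; by rewrite -scalemxAr.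
  rewrite {1}wq dotZl dotZr mulrA -expr2; congr (_ * _).
  (* After a full run the number of nodes equals the number of steps, and the degree is below twice
     that; after a breakdown all moments agree. *)
  apply: mom; case: hn => [->|]; last by right.
  by left; apply: leq_trans sp.
rewrite pq in appA.
rewrite -frobnorm_dot in appA *.
set F2 := frobnorm w ^+ 2 in appA *.
have F20 : 0 <= F2 by rewrite sqr_ge0.
set X := qf _ w in appA *; set Y := qf _ _ in appA appT *; set Z := qf _ (e1 R _) in appT *.
have -> : F2 * Z - X = F2 * (Z - Y) - (X - F2 * Y) by ring.
apply: le_trans (ler_normB _ _) _; rewrite normrM (ger0_norm F20).
have : F2 * `|Z - Y| <= F2 * e by rewrite ler_wpM2l.
move: appA; lra.
Qed.

(** * Chebyshev approximation of the logarithm *)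

Section RealDerivatives.
Variable R : realType.
Implicit Types (f g : R -> R) (x : R).

Lemma der_eq f x a b : is_derive x 1 f a -> a = b -> is_derive x 1 f b.
Proof. by move=> h <-. Qed.

Lemma der_id x : is_derive x 1 (fun y : R => y) 1.
Proof. exact: is_derive_id. Qed.

Lemma der_cst (c : R) x : is_derive x 1 (fun _ : R => c) 0.
Proof. exact: is_derive_cst. Qed.

Lemma derD f g x a b : is_derive x 1 f a -> is_derive x 1 g b ->
  is_derive x 1 (fun y => f y + g y) (a + b).
Proof. by move=> hf hg; exact: is_deriveD. Qed.

Lemma derM f g x a b : is_derive x 1 f a -> is_derive x 1 g b ->
  is_derive x 1 (fun y => f y * g y) (a * g x + f x * b).
Proof.
by move=> hf hg; apply: der_eq (is_deriveM hf hg) _; rewrite addrC [RHS]addrC /GRing.scale /=; ring.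
Qed.

Lemma derZ f x a (c : R) : is_derive x 1 f a -> is_derive x 1 (fun y => c * f y) (c * a).
Proof. by move=> hf; apply: der_eq (derM (der_cst c x) hf) _; ring. Qed.

Lemma derN f x a : is_derive x 1 f a -> is_derive x 1 (fun y => - f y) (- a).
Proof. by move=> hf; exact: is_deriveN. Qed.

Lemma derB f g x a b : is_derive x 1 f a -> is_derive x 1 g b ->
  is_derive x 1 (fun y => f y - g y) (a - b).
Proof. by move=> hf hg; apply: derD hf (derN hg). Qed.

Lemma derXn n x : is_derive x 1 (fun y : R => y ^+ n) (n%:R * x ^+ n.-1).
Proof.
elim: n => [|n IHn]; first by apply: der_eq (der_cst 1 x) _; rewrite mul0r.
have -> : (fun y : R => y ^+ n.+1) = (fun y => y * y ^+ n).
  by apply/funext => y; rewrite exprS.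
apply: der_eq (derM (der_id x) IHn) _; case: n {IHn} => [|n] /=; first by rewrite !expr0; ring.
by rewrite exprS -[n.+2%:R]natr1; ring.
Qed.

Lemma der_expR f x a : is_derive x 1 f a ->
  is_derive x 1 (fun y => expR (f y)) (expR (f x) * a).
Proof. by move=> hf; exact: (is_derive1_comp (is_derive_expR (f x)) hf). Qed.

Lemma der_ln f x a : 0 < f x -> is_derive x 1 f a ->
  is_derive x 1 (fun y => ln (f y)) (a / f x).
Proof. by move=> f0 hf; apply: der_eq (is_derive1_comp (is_derive1_ln f0) hf) _; rewrite mulrC. Qed.

Lemma der_sum n (h : 'I_n -> R -> R) x dh : (forall i, is_derive x 1 (h i) (dh i)) ->
  is_derive x 1 (fun y => \sum_i h i y) (\sum_i dh i).
Proof.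
move=> hd; have -> : (fun y => \sum_i h i y) = \sum_i h i by apply/funext => y; rewrite fct_sumE.
exact: is_derive_sum.
Qed.

Lemma ge0_derive_le f f' (a b : R) : a <= b ->
  (forall x, a <= x <= b -> is_derive x 1 f (f' x)) ->
  (forall x, a <= x <= b -> 0 <= f' x) -> f a <= f b.
Proof.
move=> ab fd f0; have [||c cab E] := @MVT_segment R f f' a b ab.
- by move=> x; rewrite in_itv /= => /andP[h1 h2]; apply: fd; rewrite !ltW.
- apply: derivable_within_continuous => x; rewrite in_itv /= => hx.
  by case: (fd x hx).
- rewrite -subr_ge0 E mulr_ge0 ?subr_ge0 // f0 //.
Qed.

(* Equivalent to tanh y <= y. *)
Lemma expR_tanh_le (y : R) : 0 <= y -> (1 - y) * expR y <= (1 + y) * expR (- y).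
Proof.
move=> y0; rewrite -subr_ge0.
pose f z : R := (1 + z) * expR (- z) - (1 - z) * expR z.
have -> : 0 = f 0 by rewrite /f oppr0 !expR0; ring.
apply: (@ge0_derive_le f (fun z => z * (expR z - expR (- z))) 0 y y0).
  move=> z _; rewrite /f; have dm := der_expR (derN (der_id z)).
  have dp := der_expR (der_id z).
  apply: der_eq (derB (derM (derD (der_cst 1 z) (der_id z)) dm)
                      (derM (derB (der_cst 1 z) (der_id z)) dp)) _; ring.
by move=> z /andP[z0 _]; rewrite mulr_ge0 // subr_ge0 ler_expR; lra.
Qed.

(** The function exp(-z^2 / 2) cosh z decreases for z >= 0, the sign of its derivative being given
    by tanh z <= z; evenness covers negative y. *)
Lemma cosh_le (y : R) : expR y + expR (- y) <= 2 * expR (y ^+ 2 / 2).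
Proof.
wlog y0 : y / 0 <= y.
  move=> H; have [/H//|y0] := leP 0 y.
  by have := H (- y); rewrite opprK sqrrN addrC; apply; rewrite oppr_ge0 ltW.
pose f z : R := - (expR (- (z ^+ 2 / 2)) * (expR z + expR (- z))).
have : f 0 <= f y.
  apply: (@ge0_derive_le f (fun z => expR (- (z ^+ 2 / 2)) *
     ((1 + z) * expR (- z) - (1 - z) * expR z)) 0 y y0).
    move=> z _; rewrite /f; have dm := der_expR (derN (der_id z)).
    have dp := der_expR (der_id z).
    have d2 := der_expR (derN (derM (derXn 2 z) (der_cst (2^-1) z))).
    by apply: der_eq (derN (derM d2 (derD dp dm))) _; rewrite /= expr1; field.
  by move=> z /andP[z0 _]; rewrite mulr_ge0 ?expR_ge0 // subr_ge0 expR_tanh_le.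
rewrite /f expr0n /= mul0r oppr0 expR0 lerN2 [expR (- (y ^+ 2 / 2))]expRN => h.
have := expR_gt0 (y ^+ 2 / 2); move: h; set E := expR (y ^+ 2 / 2) => h E0.
rewrite -(ler_pM2l (_ : 0 < E^-1)) ?invr_gt0 //.
by rewrite mulrCA mulVf ?lt0r_neq0 //; apply: le_trans h _; lra.
Qed.

End RealDerivatives.

(** * Chebyshev polynomials and the truncated expansion of the logarithm *)

Section Chebyshev.
Variable R : realType.

(** Consecutive pairs (T_k, T_{k+1}) make the two-term recurrence structural. *)
Fixpoint cheb2 (k : nat) : {poly R} * {poly R} :=
  if k is k'.+1 then ((cheb2 k').2, 2 *: ('X * (cheb2 k').2) - (cheb2 k').1)
  else (1, 'X).

Definition cheb k := (cheb2 k).1.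

Lemma cheb0 : cheb 0 = 1. Proof. by []. Qed.
Lemma cheb1 : cheb 1 = 'X. Proof. by []. Qed.
Lemma chebSS k : cheb k.+2 = 2 *: ('X * cheb k.+1) - cheb k.
Proof. by []. Qed.

Lemma size_cheb k : (size (cheb k) <= k.+1)%N.
Proof.
suff : (size (cheb k) <= k.+1)%N && (size (cheb k.+1) <= k.+2)%N by case/andP.
elim: k => [|k /andP[h1 h2]]; first by rewrite cheb0 cheb1 size_poly1 size_polyX.
rewrite h2 chebSS /= (leq_trans (size_polyD _ _)) // geq_max size_polyN.
rewrite (leq_trans h1) ?andbT; last by lia.
by rewrite (leq_trans (size_scale_leq _ _)) // (leq_trans (size_polyMleq _ _)) // size_polyX.
Qed.

Lemma cheb_trig (t s : R) k : t ^+ 2 + s ^+ 2 = 1 -> exists c d,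
  [/\ c ^+ 2 + d ^+ 2 = 1, (cheb k).[t] = c & (cheb k.+1).[t] = c * t - d * s].
Proof.
move=> ts; elim: k => [|k [c [d [cd Tk TSk]]]].
  by exists 1, 0; rewrite cheb0 cheb1 hornerX hornerC; split => //; ring.
exists (c * t - d * s), (d * t + c * s); split => //.
  have -> : (c * t - d * s) ^+ 2 + (d * t + c * s) ^+ 2 =
     (c ^+ 2 + d ^+ 2) * (t ^+ 2 + s ^+ 2) by ring.
  by rewrite cd ts mulr1.
rewrite chebSS hornerD hornerN hornerZ hornerM hornerX Tk TSk.
have cE : c = c * (t ^+ 2 + s ^+ 2) by rewrite ts mulr1.
rewrite [X in _ - X = _]cE.
ring.
Qed.

(** For t = cos a the left side is the squared real part of e^(ika) (e^(ia) + x), and the right side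
    is its squared modulus; the difference is the square of the imaginary part. *)
Lemma cheb_comb_bound (t x : R) k : -1 <= t <= 1 ->
  ((cheb k.+1).[t] + x * (cheb k).[t]) ^+ 2 <= 1 + 2 * t * x + x ^+ 2.
Proof.
move=> /andP[t1 t2].
have ts : t ^+ 2 + (Num.sqrt (1 - t ^+ 2)) ^+ 2 = 1.
  by rewrite sqr_sqrtr ?subrKC //; nra.
have [c [d [cd -> ->]]] := cheb_trig k ts; move: (Num.sqrt _) ts => s ts.
have -> : 1 + 2 * t * x + x ^+ 2 = (c ^+ 2 + d ^+ 2) * ((t + x) ^+ 2 + s ^+ 2).
  have sE : s ^+ 2 = 1 - t ^+ 2 by rewrite -ts; ring.
  by rewrite cd mul1r sE; ring.
rewrite -subr_ge0.
have -> : (c ^+ 2 + d ^+ 2) * ((t + x) ^+ 2 + s ^+ 2) - (c * t - d * s + x * c) ^+ 2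
   = (c * s + d * (t + x)) ^+ 2 by ring.
exact: sqr_ge0.
Qed.

(** Generating function of the T_k with its exact remainder. Divided by 1 + 2 t x + x^2, the term t
    + x is half the derivative of ln (1 + 2 t x + x^2) in x. *)
Lemma cheb_geometric (t x : R) n :
  (1 + 2 * t * x + x ^+ 2) * \sum_(i < n) (-1) ^+ i * x ^+ i * (cheb i.+1).[t]
  = t + x - (-1) ^+ n * x ^+ n * ((cheb n.+1).[t] + x * (cheb n).[t]).
Proof.
elim: n => [|n IHn]; first by rewrite big_ord0 cheb0 cheb1 hornerX hornerC !expr0; ring.
rewrite big_ord_recr /= mulrDr IHn chebSS hornerD hornerN hornerZ hornerM hornerX.
rewrite !exprS; ring.
Qed.

(** The error is viewed as a function of x on [0, q], zero at x = 0. Its derivative is the remainder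
    of [cheb_geometric], at most 2 x^n / sqrt D(x) with D(x) >= (1 - q)^2; comparison with the
    primitive of 2 x^n / (1 - q) bounds it on both sides. *)
Lemma ln_cheb_error (t q : R) n : -1 <= t <= 1 -> 0 <= q < 1 ->
  `|ln (1 + 2 * t * q + q ^+ 2)
    - 2 * \sum_(i < n) (-1) ^+ i * q ^+ i.+1 / i.+1%:R * (cheb i.+1).[t]|
  <= 2 * q ^+ n.+1 / (n.+1%:R * (1 - q)).
Proof.
move=> t1 /andP[q0 q1].
pose D (x : R) : R := 1 + 2 * t * x + x ^+ 2.
have D0 (x : R) : 0 <= x <= q -> (1 - q) ^+ 2 <= D x.
  by move=> /andP[x0 xq]; move: t1 => /andP[t1 t2]; rewrite /D; nra.
have Dp (x : R) : 0 <= x <= q -> 0 < D x.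
  by move=> hx; apply: lt_le_trans (D0 x hx); rewrite exprn_gt0 // subr_gt0.
pose g (x : R) : R := ln (D x) - 2 * \sum_(i < n) (-1) ^+ i * x ^+ i.+1 / i.+1%:R * (cheb i.+1).[t].
pose h (x : R) : R := 2 / (n.+1%:R * (1 - q)) * x ^+ n.+1.
pose g' (x : R) : R := 2 * ((-1) ^+ n * x ^+ n * ((cheb n.+1).[t] + x * (cheb n).[t])) / D x.
pose h' (x : R) : R := 2 / (1 - q) * x ^+ n.
have nS : n.+1%:R != 0 :> R by rewrite pnatr_eq0.
have q10 : 1 - q != 0 by rewrite subr_eq0 gt_eqF.
have dh (x : R) : is_derive x 1 h (h' x).
  by apply: der_eq (derZ _ (derXn n.+1 x)) _; rewrite /h' /=; move: (n.+1%:R : R) nS => N1 nS; field; rewrite ?nS ?q10.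
have dg (x : R) : 0 <= x <= q -> is_derive x 1 g (g' x).
  move=> hx; have dD : is_derive x 1 D (2 * (t + x)).
    apply: der_eq (derD (derD (der_cst 1 x) (derZ (2 * t) (der_id x))) (derXn 2 x)) _.
    by rewrite /= expr1; ring.
  have ds := @der_sum R n (fun i x => (-1) ^+ i * x ^+ i.+1 / i.+1%:R * (cheb i.+1).[t]) x
    (fun i => (-1) ^+ i * x ^+ i * (cheb i.+1).[t]).
  apply: der_eq (derB (der_ln (Dp x hx) dD) (derZ 2 (ds _))) _.
    move=> i; have -> : (fun x => (-1) ^+ i * x ^+ i.+1 / i.+1%:R * (cheb i.+1).[t]) =
       (fun x => ((-1) ^+ i / i.+1%:R * (cheb i.+1).[t]) * x ^+ i.+1) by apply/funext => z; ring.
    apply: der_eq (derZ _ (derXn _ _)) _ => /=.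
    have iS : i.+1%:R != 0 :> R by rewrite pnatr_eq0.
    by move: (i.+1%:R : R) iS => N1 iS; field.
  have Dx0 : D x != 0 by rewrite gt_eqF // Dp.
  rewrite /g'; have := cheb_geometric t x n; rewrite -/(D x) => E.
  set S := \sum_(i < n) _ in E *; have {E} : (-1) ^+ n * x ^+ n * ((cheb n.+1).[t] + x * (cheb n).[t]) =
    t + x - D x * S by rewrite E; ring.
  by move=> ->; field.
have bnd (x : R) : 0 <= x <= q -> `|g' x| <= h' x.
  move=> hx; have Dx := Dp x hx; have /andP[x0 xq] := hx.
  have q1' : 0 < 1 - q by rewrite subr_gt0.
  have sD : 0 < Num.sqrt (D x) by rewrite sqrtr_gt0.
  have c1 : `|(cheb n.+1).[t] + x * (cheb n).[t]| <= Num.sqrt (D x).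
    by rewrite -sqrtr_sqr ler_wsqrtr // cheb_comb_bound.
  have c2 : 1 - q <= Num.sqrt (D x).
    by rewrite -(ger0_norm (ltW q1')) -sqrtr_sqr ler_wsqrtr // D0.
  rewrite /g' !normrM normfV (gtr0_norm Dx) normrX normrN normr1 expr1n mul1r.
  rewrite [`|2|]ger0_norm // [`|x ^+ n|]ger0_norm ?exprn_ge0 //.
  rewrite ler_pdivrMr // -[X in _ <= _ * X](sqr_sqrtr (ltW Dx)) /h'.
  have xn0 : 0 <= x ^+ n by rewrite exprn_ge0.
  have -> : 2 / (1 - q) * x ^+ n * Num.sqrt (D x) ^+ 2 =
    2 * (x ^+ n * (Num.sqrt (D x) ^+ 2 / (1 - q))) by field.
  rewrite ler_wpM2l // ler_wpM2l //; apply: le_trans c1 _.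
  by rewrite ler_pdivlMr // expr2 ler_wpM2l // ltW.
have E0 : g 0 = 0.
  rewrite /g /D big1 ?mulr0 ?subr0; last by move=> i _; rewrite expr0n /= mulr0 !mul0r.
  by rewrite expr0n /= !addr0 ln1.
have h0 : h 0 = 0 by rewrite /h expr0n /= mulr0.
have -> : 2 * q ^+ n.+1 / (n.+1%:R * (1 - q)) = h q by rewrite /h mulrAC.
rewrite -/(D q) -/(g q) ler_norml; apply/andP; split.
- rewrite -subr_ge0 opprK; have -> : 0 = g 0 + h 0 by rewrite E0 h0 addr0.
  apply: (@ge0_derive_le R (fun x => g x + h x) (fun x => g' x + h' x) 0 q q0).
    by move=> x hx; apply: derD (dg x hx) (dh x).
  move=> x hx; have := bnd x hx; rewrite ler_norml => /andP[b1 _]; lra.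
- rewrite -subr_ge0; have -> : 0 = h 0 - g 0 by rewrite E0 h0 subr0.
  apply: (@ge0_derive_le R (fun x => h x - g x) (fun x => h' x - g' x) 0 q q0).
    by move=> x hx; apply: derB (dh x) (dg x hx).
  move=> x hx; have := bnd x hx; rewrite ler_norml => /andP[_ b1]; lra.
Qed.

Lemma ln_poly_approx (alpha beta : R) n : 0 < alpha -> alpha <= beta ->
  let q := (Num.sqrt beta - Num.sqrt alpha) / (Num.sqrt beta + Num.sqrt alpha) in
  exists p : {poly R}, (size p <= n.+1)%N /\
    forall z, alpha <= z <= beta ->
      `|ln z - p.[z]| <= 2 * q ^+ n.+1 / (n.+1%:R * (1 - q)).
Proof.
move=> al0 ab; have be0 := lt_le_trans al0 ab.
set a := Num.sqrt alpha; set b := Num.sqrt beta => q.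
have a0 : 0 < a by rewrite sqrtr_gt0.
have a2 : a ^+ 2 = alpha by rewrite sqr_sqrtr // ltW.
have b2 : b ^+ 2 = beta by rewrite sqr_sqrtr // ltW.
have ab' : a <= b by rewrite ler_wsqrtr.
have abp : 0 < b + a by lra.
have q01 : 0 <= q < 1.
  by rewrite divr_ge0 ?subr_ge0 ?(ltW abp) //= ltr_pdivrMr // mul1r; lra.
(* For q = 0 the interval is a single point and a constant suffices; the affine map below divides by
   q. *)
have [q0|qn0] := eqVneq q 0.
  exists (ln alpha)%:P; split; first by rewrite (leq_trans (size_polyC_leq1 _)).
  have eab : alpha = beta.
    move: q0 => /eqP; rewrite mulf_eq0 invr_eq0 (gt_eqF abp) orbF subr_eq0 => /eqP E.
    by rewrite -a2 -b2 E.
  move=> z; rewrite -eab => hz; have -> : z = alpha by lra.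
  by rewrite hornerC subrr normr0 q0 expr0n /= mulr0 mul0r.
have [q0 q1] := andP q01; have qp : 0 < q by rewrite lt_neqAle eq_sym qn0.
(* Chosen so that C (1 - q)^2 = alpha and C (1 + q)^2 = beta. Then z = C (1 + 2 t q + q^2) with t
   affine in z, running over [-1, 1] as z runs over the interval. *)
pose C := ((a + b) / 2) ^+ 2.
have C0 : 0 < C by rewrite exprn_gt0 // divr_gt0 //; lra.
have Cn0 := lt0r_neq0 C0.
have abn0 := lt0r_neq0 abp.
have Cal : C * (1 - q) ^+ 2 = alpha by rewrite -a2 /C /q; field.
have Cbe : C * (1 + q) ^+ 2 = beta by rewrite -b2 /C /q; field.
pose L : {poly R} := (2 * q * C)^-1 *: 'X - ((1 + q ^+ 2) / (2 * q))%:P.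
have sL : (size L <= 2)%N.
  rewrite (leq_trans (size_polyD _ _)) // geq_max size_polyN.
  rewrite (leq_trans (size_scale_leq _ _)) ?size_polyX //=.
  by rewrite (leq_trans (size_polyC_leq1 _)).
exists ((ln C)%:P + 2 *: \sum_(i < n) ((-1) ^+ i * q ^+ i.+1 / i.+1%:R) *: (cheb i.+1 \Po L)).
split.
  rewrite (leq_trans (size_polyD _ _)) // geq_max (leq_trans (size_polyC_leq1 _)) //=.
  rewrite (leq_trans (size_scale_leq _ _)) // (leq_trans (size_sum _ _ _)) //.
  apply/bigmax_leqP => i _; rewrite (leq_trans (size_scale_leq _ _)) //.
  rewrite (leq_trans (size_comp_poly_leq _ _)) //.
  have sL1 : ((size L).-1 <= 1)%N by case: (size L) sL.
  have sc : ((size (cheb i.+1)).-1 <= i.+1)%N.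
    by case: (size _) (size_cheb i.+1).
  by rewrite ltnS (leq_trans (leq_mul sc sL1)) // muln1.
move=> z /andP[z1 z2].
set t := L.[z].
have tE : t = (z / C - 1 - q ^+ 2) / (2 * q).
  by rewrite /t /L hornerD hornerN hornerC hornerZ hornerX; field; rewrite ?qn0 ?Cn0.
have zE : z = C * (1 + 2 * t * q + q ^+ 2) by rewrite tE; field; rewrite ?qn0 ?Cn0.
have t1 : -1 <= t <= 1.
  have Cq : 0 < C * q by rewrite mulr_gt0.
  move: z1 z2; rewrite -Cal -Cbe zE; clearbody t C q => z1 z2.
  by rewrite -(ler_pM2l Cq) -[t <= 1](ler_pM2l Cq); apply/andP; split; lra.
have W0 : 0 < 1 + 2 * t * q + q ^+ 2.
  by rewrite -(pmulr_rgt0 _ C0) -zE (lt_le_trans al0).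
rewrite hornerD hornerC hornerZ horner_sum.
under eq_bigr => i _ do rewrite hornerZ horner_comp -/t.
rewrite {1}zE lnM ?posrE // opprD addrACA subrr add0r.
exact: ln_cheb_error.
Qed.

(** Degree 2K - 1 is what K Lanczos steps integrate exactly. With s = sqrt kappa, q = (s - 1) / (s +
    1) <= exp(-2 / s) by tanh y <= y at y = 1 / s, so q^(2K) <= exp(-4K / s), which is at most the
    inverse of the argument of the logarithm in the bound on K. *)
Lemma ln_poly_approx_rate (alpha beta eps : R) (m K : nat) :
  0 < alpha -> alpha <= beta -> 0 < eps -> (0 < m)%N -> (0 < K)%N ->
  let kappa := beta / alpha in
  K%:R >= Num.sqrt (kappa + 1) / 4 *
          ln (4 * (5 / 2) * eps^-1 * m%:R * (Num.sqrt (kappa + 1) + 1) * ln (2 * kappa)) ->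
  exists e (p : {poly R}), [/\ (size p <= K.*2)%N,
    forall z, alpha <= z <= beta -> `|ln z - p.[z]| <= e & 2 * e * m%:R <= eps / 5].
Proof.
move=> al0 ab e0 m0 K0 kappa HK; have be0 := lt_le_trans al0 ab.
have [p [sp Hp]] := ln_poly_approx (K.*2).-1 al0 ab.
have K2 : (K.*2).-1.+1 = K.*2 by rewrite prednK // double_gt0.
rewrite K2 in sp Hp; do 2 eexists; split; [exact: sp|exact: Hp|].
set a := Num.sqrt alpha in Hp *; set b := Num.sqrt beta in Hp *.
have a0 : 0 < a by rewrite sqrtr_gt0.
have b0 : 0 < b by rewrite sqrtr_gt0.
have ab' : a <= b by rewrite ler_wsqrtr.
have abp : 0 < b + a by lra.
set q := (b - a) / (b + a).
have q0 : 0 <= q by rewrite divr_ge0 ?subr_ge0 // ltW.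
pose s := Num.sqrt kappa; pose s1 := Num.sqrt (kappa + 1).
have k1 : 1 <= kappa by rewrite ler_pdivlMr // mul1r.
have sE : s = b / a by rewrite /s /kappa sqrtrM ?ltW // sqrtrV // ltW.
have ss1 : s <= s1 by rewrite ler_wsqrtr // lerDl.
have s0 : 0 < s by rewrite sE divr_gt0.
have s10 : 0 < s1 := lt_le_trans s0 ss1.
(* From 1 - ln 2 <= exp(-ln 2) = 1/2. At the end this turns eps / (10 ln (2 kappa)) into eps / 5. *)
have ln2k : 1 / 2 <= ln (2 * kappa).
  have : 1 / 2 <= ln 2 :> R.
    have := expR_ge1Dx (- ln 2 : R).
    by rewrite expRN lnK ?posrE //; lra.
  move/le_trans; apply; rewrite ler_ln ?posrE //; lra.
set X := 4 * (5 / 2) * eps^-1 * m%:R * (s1 + 1) * ln (2 * kappa).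
have mp : 0 < m%:R :> R by rewrite ltr0n.
have lp : 0 < ln (2 * kappa) by lra.
have s11 : 0 < s1 + 1 by lra.
have X0 : 0 < X by rewrite /X !mulr_gt0 // ?invr_gt0.
have qK : q ^+ K.*2 <= X^-1.
  have qe : q <= expR (- (2 / s)).
    have := @expR_tanh_le R (a / b) (divr_ge0 (ltW a0) (ltW b0)).
    have -> : - (2 / s) = - (a / b) + - (a / b).
      by rewrite sE; field; rewrite !gt_eqF.
    rewrite expRD; set E := expR (- (a / b)); have E0 : 0 < E := expR_gt0 _.
    have -> : expR (a / b) = E^-1 by rewrite /E expRN invrK.
    rewrite ler_pdivrMr // => h; rewrite /q ler_pdivrMr //.
    have -> : b - a = b * (1 - a / b) by field; rewrite gt_eqF.
    have -> : E * E * (b + a) = b * ((1 + a / b) * E * E) by field; rewrite gt_eqF.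
    by rewrite ler_pM2l.
  apply: (@le_trans _ _ (expR (- (2 / s)) ^+ K.*2)).
    by rewrite lerXn2r // nnegrE ?expR_ge0.
  rewrite -expRM_natl -[X^-1](@lnK R) ?posrE ?invr_gt0 // ler_expR lnV ?posrE //.
  rewrite mulrN lerN2.
  have : ln X <= 4 * K%:R / s1.
    by rewrite ler_pdivlMr // mulrC; move: HK; rewrite -/s1 -/X; lra.
  move/le_trans; apply; rewrite -muln2 natrM.
  have -> : K%:R * 2 * (2 / s) = 4 * K%:R / s by ring.
  rewrite ler_wpM2l ?lef_pV2 ?posrE // mulr_ge0 //.
have q1E : (1 - q)^-1 = (s + 1) / 2 by rewrite /q sE; field; rewrite !gt_eqF //; lra.
have K1 : 1 <= K%:R :> R by rewrite ler1n.
have -> : 2 * (2 * q ^+ K.*2 / (K.*2%:R * (1 - q))) * m%:R =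
   m%:R * (s + 1) * q ^+ K.*2 / K%:R.
  rewrite invfM q1E -muln2 natrM; field; by rewrite gt_eqF // ltr0n.
have Q0 : 0 <= q ^+ K.*2 by rewrite exprn_ge0.
apply: (@le_trans _ _ (m%:R * (s1 + 1) * X^-1)).
  rewrite ler_pdivrMr ?ltr0n //; apply: (@le_trans _ _ (m%:R * (s1 + 1) * X^-1 * 1)); last first.
    by rewrite ler_wpM2l // mulr_ge0 ?invr_ge0 ?(ltW X0) // mulr_ge0 ?ltW.
  rewrite mulr1 ler_pM // ?mulr_ge0 ?(ltW mp) //; [lra|].
  by rewrite ler_wpM2l ?(ltW mp) // lerD2r.
have -> : m%:R * (s1 + 1) * X^-1 = eps / (10 * ln (2 * kappa)).
  by rewrite /X; field; rewrite !gt_eqF.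
by rewrite ler_pdivrMr ?mulr_gt0 //; nra.
Qed.

End Chebyshev.

(** * Rademacher chaos *)

Section RademacherChaos.
Variable R : realType.

Definition fcons n (b : bool) (s : {ffun 'I_n -> bool}) : {ffun 'I_n.+1 -> bool} :=
  [ffun i => if unlift ord0 i is Some j then s j else b].

Lemma sum_ffun_ordS n (F : {ffun 'I_n.+1 -> bool} -> R) :
  \sum_s F s = \sum_s (F (fcons true s) + F (fcons false s)).
Proof.
pose h (bs : bool * {ffun 'I_n -> bool}) := fcons bs.1 bs.2.
pose g (s : {ffun 'I_n.+1 -> bool}) := (s ord0, [ffun j => s (lift ord0 j)]).
rewrite (reindex h) /=; last first.
  apply: onW_bij; exists g => [[b s]|s]; rewrite /h /g /=.
    congr pair; first by rewrite ffunE unlift_none.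
    by apply/ffunP => j; rewrite !ffunE liftK.
  apply/ffunP => i; rewrite ffunE; case: unliftP => [j ->|-> //].
  by rewrite ffunE.
rewrite -(pair_bigA _ (fun b s => F (fcons b s))) /=.
by rewrite big_bool /= -big_split.
Qed.

Lemma rademacher_fcons n b (s : {ffun 'I_n -> bool}) :
  rademacher R (fcons b s) = col_mx ((if b then 1 else -1)%:M : 'cV[R]_1) (rademacher R s)
    :> 'cV[R]_(1 + n).
Proof.
apply/colP => i; rewrite !mxE ffunE; case: split_ordP => j ->.
  by rewrite ord1 (_ : lshift n 0 = ord0) ?unlift_none ?mxE //; apply/val_inj.
by rewrite (_ : rshift 1 j = lift ord0 j) ?liftK ?mxE //; apply/val_inj.
Qed.

Lemma dot_col_mx n (a b : R) (x y : 'cV[R]_n) :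
  dot (col_mx a%:M x) (col_mx b%:M y) = a * b + dot x y.
Proof. by rewrite /dot tr_col_mx mul_row_col tr_scalar_mx mxE -scalar_mxM mxE eqxx mulr1n. Qed.

Lemma qf_block n (c a : R) (b : 'cV[R]_n) (M : 'M[R]_n) (y : 'cV[R]_n) :
  qf (block_mx c%:M b^T b M) (col_mx a%:M y) = c * a ^+ 2 + 2 * a * dot b y + qf M y.
Proof.
rewrite /qf mul_block_col.
have -> : c%:M *m a%:M + b^T *m y = (c * a + dot b y)%:M :> 'M[R]_1.
  by rewrite -scalar_mxM [b^T *m y]mx11_scalar -/(dot b y) raddfD.
by rewrite dot_col_mx mul_mx_scalar dotDr dotZr [dot y b]dotC; ring.
Qed.

Lemma det_schur n (d : R) (v : 'cV[R]_n) (E : 'M[R]_n) : d != 0 ->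
  \det (block_mx d%:M v^T v E) = d * \det (E - d^-1 *: (v *m v^T)).
Proof.
move=> d0; pose P : 'M[R]_(1 + n) := block_mx 1%:M 0 (- (d^-1 *: v)) 1%:M.
have -> : \det (block_mx d%:M v^T v E) = \det (P *m block_mx d%:M v^T v E).
  by rewrite det_mulmx det_lblock !det1 !mul1r.
rewrite /P mulmx_block !mul1mx !mul0mx !addr0 mulNmx mul_mx_scalar scalerA mulfV // scale1r.
by rewrite addNr det_ublock det_scalar1 mulNmx -scalemxAl addrC.
Qed.

Lemma one_sub_block n (c : R) (b : 'cV[R]_n) (M : 'M[R]_n) :
  1%:M - 2 *: block_mx c%:M b^T b M =
  block_mx (1 - 2 * c)%:M (- 2 *: b)^T (- 2 *: b) (1%:M - 2 *: M).
Proof.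
rewrite scalar_mx_block scale_block_mx opp_block_mx add_block_mx !add0r; congr block_mx.
- by rewrite scale_scalar_mx -raddfB.
- by apply/matrixP => i j; rewrite !mxE mulNr.
- by rewrite scaleNr.
Qed.

Lemma det_mxfun n (U : 'M[R]_n) (d : 'rV[R]_n) f : U^T *m U = 1%:M ->
  \det (mxfun U d f) = \prod_i f (d 0 i).
Proof.
move=> UU; rewrite /mxfun !det_mulmx mulrAC -det_mulmx orthoV // det1 mul1r det_diag.
by apply: eq_bigr => i _; rewrite mxE.
Qed.

(* One sign is integrated out at a time, cosh y <= exp (y^2 / 2) playing the
   role of the Gaussian integral; the matrix left over is a Schur complement. *)
Theorem rademacher_chaos_mgf n (M : 'M[R]_n) : M^T = M -> (forall i, 0 <= M i i) ->
  (forall x : 'cV[R]_n, x != 0 -> 2 * qf M x < dot x x) ->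
  (\sum_s expR (qf M (rademacher R s))) * Num.sqrt (\det (1%:M - 2 *: M)) <= 2 ^+ n.
Proof.
elim: n M => [|n IHn] M MT Mdiag Mpos.
  rewrite det_mx00 sqrtr1 mulr1 expr0 (eq_bigr (fun=> 1)) => [|s _].
    by rewrite sumr_const card_ffun card_bool card_ord expn0.
  by rewrite /qf dotE big_ord0 expR0.
pose c := M 0 0; pose b : 'cV[R]_n := dlsubmx (M : 'M[R]_(1 + n)).
pose M' : 'M[R]_n := drsubmx (M : 'M[R]_(1 + n)).
have ME : (M : 'M[R]_(1 + n)) = block_mx c%:M b^T b M'.
  rewrite -[LHS](@submxK R 1 n 1 n); congr block_mx.
    rewrite [LHS]mx11_scalar /c !mxE; congr ((M _ _)%:M); exact/val_inj.
  by rewrite /b trmx_dlsub MT.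
have Mpos' (x : 'cV[R]_(1 + n)) : x != 0 -> 2 * qf (block_mx c%:M b^T b M') x < dot x x.
  by rewrite -ME; exact: Mpos.
have c0 : 0 <= c := Mdiag 0.
have c1 : 0 < 1 - 2 * c.
  have e0 : col_mx (1%:M) 0 != 0 :> 'cV[R]_(1 + n).
    by rewrite -dot_eq0 dot_col_mx dot0r addr0 mulr1 oner_neq0.
  have := Mpos' _ e0; rewrite qf_block dot_col_mx /qf !dot0r mulmx0 dot0r.
  by lra.
have c1n := lt0r_neq0 c1.
(* I - 2 M2 is the Schur complement of the corner 1 - 2c in I - 2M. Since c >= 0, the weight 2 / (1
   - 2c) is at least 2, which covers the term (2 b.w)^2 / 2 produced by averaging over the first
   sign w.r.t. the bound on cosh. *)
pose M2 := M' + (2 / (1 - 2 * c)) *: (b *m b^T).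
have qM2 y : qf M2 y = qf M' y + 2 / (1 - 2 * c) * dot b y ^+ 2.
  rewrite /M2 qfD qfZ; congr (_ + _ * _).
  by rewrite /qf -mulmxA [b^T *m y]mx11_scalar -/(dot b y) mul_mx_scalar dotZr dotC expr2.
have M'T : M'^T = M' by rewrite /M' trmx_drsub MT.
have M2T : M2^T = M2 by rewrite /M2 linearD /= linearZ /= trmx_mul trmxK M'T.
have M2diag i : 0 <= M2 i i.
  rewrite /M2 mxE addr_ge0 //.
    by rewrite /M' !mxE; exact: Mdiag.
  rewrite !mxE mulr_ge0 ?divr_ge0 ?(ltW c1) //.
  by rewrite big_ord1 !mxE -expr2 sqr_ge0.
have M2pos y : y != 0 -> 2 * qf M2 y < dot y y.
  (* The first coordinate that maximizes 2 qf M (a, y) - a^2; at this value the hypothesis on M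
     becomes the claim for M2. *)
  move=> y0; pose a := 2 * dot b y / (1 - 2 * c).
  have x0 : col_mx (a%:M) y != 0 :> 'cV[R]_(1 + n).
    by apply: contra y0; rewrite -(@col_mx0 _ 1 n 1) => /eqP/eq_col_mx [_ ->].
  have := Mpos' _ x0; rewrite qf_block dot_col_mx qM2.
  have -> : 2 * (qf M' y + 2 / (1 - 2 * c) * dot b y ^+ 2) =
    2 * (c * a ^+ 2 + 2 * a * dot b y + qf M' y) - a * a.
    by rewrite /a; field.
  by lra.
have IH := IHn M2 M2T M2diag M2pos.
have detE : \det (1%:M - 2 *: M) = (1 - 2 * c) * \det (1%:M - 2 *: M2).
  have -> : (1%:M - 2 *: M : 'M[R]_(1 + n)) =
     block_mx (1 - 2 * c)%:M (- 2 *: b)^T (- 2 *: b) (1%:M - 2 *: M').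
    by have := one_sub_block c b M'; rewrite -ME.
  rewrite det_schur //; congr (_ * \det _).
  have -> : (- 2 *: b) *m (- 2 *: b)^T = 4 *: (b *m b^T).
    by rewrite linearZ /= -scalemxAl -scalemxAr scalerA; congr (_ *: _); ring.
  rewrite /M2; move: (b *m b^T) => P; apply/matrixP => i j; rewrite !mxE; by field.
rewrite sum_ffun_ordS detE sqrtrM ?(ltW c1) //.
have step s : expR (qf M (rademacher R (fcons true s))) + expR (qf M (rademacher R (fcons false s)))
    <= 2 * expR c * expR (qf M2 (rademacher R s)).
  rewrite [M]ME !rademacher_fcons !qf_block qM2.
  move: (rademacher R s) => w.
  have -> : c * 1 ^+ 2 + 2 * 1 * dot b w + qf M' w = c + (qf M' w + 2 * dot b w) by ring.
  have -> : c * (-1) ^+ 2 + 2 * -1 * dot b w + qf M' w = c + (qf M' w - 2 * dot b w) by ring.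
  rewrite !expRD; set y := 2 * dot b w; set E := expR (2 / _ * _).
  have -> : expR c * (expR (qf M' w) * expR y) + expR c * (expR (qf M' w) * expR (- y)) =
    expR c * expR (qf M' w) * (expR y + expR (- y)) by ring.
  have -> : 2 * expR c * (expR (qf M' w) * E) = expR c * expR (qf M' w) * (2 * E) by ring.
  rewrite ler_wpM2l ?mulr_ge0 ?expR_ge0 //; apply: le_trans (cosh_le _) _; rewrite /E /y.
  rewrite ler_wpM2l // ler_expR exprMn mulrAC ler_wpM2r ?sqr_ge0 //.
  by rewrite ler_pdivlMr //; lra.
apply: (@le_trans _ _ ((\sum_s 2 * expR c * expR (qf M2 (rademacher R s))) *
    (Num.sqrt (1 - 2 * c) * Num.sqrt (\det (1%:M - 2 *: M2))))).
  by rewrite ler_wpM2r ?mulr_ge0 ?sqrtr_ge0 //; apply: ler_sum => s _; exact: step.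
rewrite -mulr_sumr exprS; set S := \sum_s _; set D := Num.sqrt (\det _).
have -> : 2 * expR c * S * (Num.sqrt (1 - 2 * c) * D) =
   2 * ((expR c * Num.sqrt (1 - 2 * c)) * (S * D)) by ring.
rewrite ler_wpM2l //.
have SD0 : 0 <= S * D by rewrite mulr_ge0 ?sqrtr_ge0 // sumr_ge0 // => s _; rewrite expR_ge0.
(* The factor exp c from the diagonal entry is paid for by the corner of the determinant. *)
have h1 : expR c * Num.sqrt (1 - 2 * c) <= 1.
  rewrite -[leRHS](expRxMexpNx_1 c) ler_wpM2l ?expR_ge0 //.
  rewrite -[leRHS]ger0_norm ?expR_ge0 // -sqrtr_sqr ler_wsqrtr // -expRM_natl.
  by apply: le_trans (expR_ge1Dx _); lra.
apply: le_trans IH; rewrite -[leRHS]mul1r ler_wpM2r //.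
Qed.

(** From 1 / (1 - x) = 1 + x + x^2 / (1 - x) and 1 + u <= exp u. *)
Lemma inv_expR_le (x X : R) : `|x| <= X -> X < 1 -> expR (- (x + x ^+ 2 / (1 - X))) <= 1 - x.
Proof.
rewrite ler_norml => /andP[x1 x2] X1.
have p : 0 < 1 - x by lra.
have p2 : 0 < 1 - X by lra.
have h : (1 - x)^-1 <= expR (x + x ^+ 2 / (1 - X)).
  apply: le_trans (_ : 1 + (x + x ^+ 2 / (1 - x)) <= _).
    by rewrite le_eqVlt; apply/orP; left; apply/eqP; field; rewrite lt0r_neq0.
  apply: le_trans (expR_ge1Dx _) _; rewrite ler_expR lerD2l ler_wpM2l ?sqr_ge0 //.
  by rewrite lef_pV2 ?posrE //; lra.
by rewrite expRN -[leRHS]invrK lef_pV2 ?posrE ?expR_gt0 ?invr_gt0.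
Qed.

(** The determinant is the product of the 1 - 2 lam b_i over the eigenvalues b_i of B, bounded below
    factor by factor. The linear terms sum to the trace, which is zero; the squares sum to the
    Frobenius norm, and the square root halves the exponent. *)
Lemma chaos_mgf_bound n (B : 'M[R]_n) (S lam : R) : B^T = B -> (forall i, B i i = 0) ->
  (forall x, `|qf B x| <= S * dot x x) -> 0 <= S -> 0 <= lam -> 2 * lam * S < 1 ->
  \sum_s expR (lam * qf B (rademacher R s))
    <= 2 ^+ n * expR (2 * lam ^+ 2 * frobnorm B ^+ 2 / (1 - 2 * lam * S)).
Proof.
move=> BT B0 BS S0 l0 lS.
have [U [b [UU BE]]] := sym_spectral BT; rewrite -mxfun_id in BE.
have bS i : `|2 * lam * b 0 i| <= 2 * lam * S.
  rewrite normrM ger0_norm ?mulr_ge0 // ler_wpM2l ?mulr_ge0 //.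
  by have := BS (col i U); rewrite BE qf_col // dot_col_ortho // mulr1.
have trB : \sum_i b 0 i = 0.
  rewrite -(tr_mxfun b id UU) -BE /mxtrace big1 // => i _; exact: B0.
have tr2B : \sum_i b 0 i ^+ 2 = frobnorm B ^+ 2.
  rewrite -(tr_mxfun b (fun z => z ^+ 2) UU).
  have -> : mxfun U b (fun z => z ^+ 2) = B *m B^T.
    by rewrite BT BE mxfunM //; apply: eq_mxfun => i; rewrite expr2.
  rewrite frobnorm_sqr /mxtrace; apply: eq_bigr => i _; rewrite mxE.
  by apply: eq_bigr => j _; rewrite mxE expr2.
have MT : (lam *: B)^T = lam *: B by rewrite linearZ /= BT.
have Mdiag i : 0 <= (lam *: B) i i by rewrite mxE B0 mulr0.
have Mpos x : x != 0 -> 2 * qf (lam *: B) x < dot x x.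
  move=> x0; have dx : 0 < dot x x by rewrite lt0r dot_eq0 x0 dot_ge0.
  rewrite qfZ; have := BS x; rewrite ler_norml => /andP[_ h].
  apply: (@le_lt_trans _ _ (2 * (lam * (S * dot x x)))).
    by rewrite ler_wpM2l // ler_wpM2l.
  by rewrite !mulrA -[ltRHS]mul1r ltr_pM2r.
have := rademacher_chaos_mgf MT Mdiag Mpos.
under eq_bigr => s _ do rewrite qfZ.
set E := 2 * lam ^+ 2 * _ / _.
have hD : expR (- E) <= Num.sqrt (\det (1%:M - 2 *: (lam *: B))).
  have -> : 1%:M - 2 *: (lam *: B) = mxfun U b (fun z => 1 - 2 * lam * z).
    rewrite {1}BE -(orthoV UU) /mxfun scalerA scalemxAl scalemxAr -mulmxBl.
    rewrite -{1}[U]mulmx1 -mulmxBr; congr (_ *m _ *m _).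
    apply/matrixP => i j; rewrite !mxE.
    by case: (i == j); rewrite ?mulr1n ?mulr0n ?mulr0 ?subr0.
  rewrite det_mxfun // -[leLHS]ger0_norm ?expR_ge0 // -sqrtr_sqr ler_wsqrtr //.
  apply: (@le_trans _ _ (\prod_i expR (- (2 * lam * b 0 i + (2 * lam * b 0 i) ^+ 2 / (1 - 2 * lam * S))))).
    rewrite -expR_sum -expRM_natl ler_expR sumrN mulrN lerN2 big_split /=.
    rewrite -mulr_sumr trB mulr0 add0r -mulr_suml.
    under eq_bigr => i _ do rewrite exprMn.
    rewrite -mulr_sumr tr2B /E le_eqVlt; apply/orP; left; apply/eqP; field.
    by rewrite subr_eq0 gt_eqF.
  apply: ler_prod => i _; rewrite expR_ge0 /=; exact: inv_expR_le.
move=> h; rewrite -ler_pdivrMr ?expR_gt0 // -expRN; apply: le_trans h.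
by rewrite ler_wpM2l // sumr_ge0 // => s _; rewrite expR_ge0.
Qed.

(** Exponential Markov inequality for the counting measure: the sum over N-tuples of sign vectors
    factors into an N-th power. F2 only bounds the squared norm, so that one value serves all points
    of a net. *)
Lemma chaos_tail n N (B : 'M[R]_n) (S F2 t : R) : B^T = B -> (forall i, B i i = 0) ->
  (forall x, `|qf B x| <= S * dot x x) -> 0 <= S -> frobnorm B ^+ 2 <= F2 -> 0 < F2 -> 0 < t ->
  #|[pred W : {ffun 'I_N -> {ffun 'I_n -> bool}} |
      t * N%:R < \sum_i qf B (rademacher R (W i))]|%:R
  <= expR (- (N%:R * t ^+ 2 / (8 * F2 + 4 * t * S))) *
     #|{: {ffun 'I_N -> {ffun 'I_n -> bool}}}|%:R.
Proof.
move=> BT B0 BS S0 BF F0 t0.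
pose V := 4 * F2 + 2 * t * S.
have V0 : 0 < V by rewrite ltr_pwDl ?mulr_gt0 // !mulr_ge0 // ltW.
(* Then 1 - 2 lam S = 4 F2 / V, and the exponent per sample, -lam t + 2 lam^2 F2 / (1 - 2 lam S),
   equals -t^2 / (2V). *)
pose lam := t / V.
have l0 : 0 <= lam by rewrite divr_ge0 ?ltW.
have lS : 1 - 2 * lam * S = 4 * F2 / V by rewrite /lam /V; field; rewrite lt0r_neq0.
have lS1 : 2 * lam * S < 1 by rewrite -subr_gt0 lS divr_gt0 ?mulr_gt0.
have mgf := chaos_mgf_bound BT B0 BS S0 l0 lS1.
set Z : {ffun 'I_N -> {ffun 'I_n -> bool}} -> R := fun W => \sum_i qf B (rademacher R (W i)).
rewrite -sum1_card natr_sum.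
apply: (@le_trans _ _ (\sum_W expR (lam * (Z W - t * N%:R)))).
  rewrite [leRHS](bigID [pred W | t * N%:R < Z W]) /= -[leLHS]addr0 lerD //; last first.
    by rewrite sumr_ge0 // => W _; rewrite expR_ge0.
  apply: ler_sum => W; rewrite inE => hW.
  by apply: le_trans (expR_ge1Dx _); rewrite lerDl mulr_ge0 // subr_ge0 ltW.
have -> : \sum_W expR (lam * (Z W - t * N%:R)) =
   expR (- (lam * t * N%:R)) * (\sum_s expR (lam * qf B (rademacher R s))) ^+ N.
  rewrite -[N in _ ^+ N]card_ord -prodr_const bigA_distr_bigA /= mulr_sumr.
  apply: eq_bigr => W _; rewrite -expR_sum -expRD; congr expR.
  by rewrite -mulr_sumr mulrBr mulrA addrC.
have -> : #|{: {ffun 'I_N -> {ffun 'I_n -> bool}}}|%:R = (2 ^+ n) ^+ N :> R.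
  by rewrite !card_ffun !card_ord card_bool !natrX.
have nn : 0 <= \sum_s expR (lam * qf B (rademacher R s)).
  by rewrite sumr_ge0 // => s _; rewrite expR_ge0.
apply: (@le_trans _ _ (expR (- (lam * t * N%:R)) *
  (2 ^+ n * expR (2 * lam ^+ 2 * F2 / (1 - 2 * lam * S))) ^+ N)).
  rewrite ler_wpM2l ?expR_ge0 // lerXn2r ?nnegrE ?mulr_ge0 ?expR_ge0 ?exprn_ge0 //.
  apply: le_trans mgf _; rewrite ler_wpM2l ?exprn_ge0 // ler_expR.
  rewrite ler_wpM2r ?invr_ge0 ?subr_ge0 ?(ltW lS1) // ler_wpM2l //.
  by rewrite mulr_ge0 ?sqr_ge0.
rewrite exprMn mulrCA mulrC ler_wpM2r ?exprn_ge0 // -expRM_natl -expRD ler_expR lS.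
rewrite le_eqVlt; apply/orP; left; apply/eqP; rewrite /lam.
have -> : 8 * F2 + 4 * t * S = 2 * V by rewrite /V; ring.
by field; rewrite !lt0r_neq0.
Qed.

End RademacherChaos.

(** * Packings of Euclidean balls *)

Section Packing.
Variable R : realType.

Lemma dotDl n (x y z : 'cV[R]_n) : dot (x + y) z = dot x z + dot y z.
Proof. by rewrite dotC dotDr !(dotC z). Qed.

Lemma dotBl n (x y z : 'cV[R]_n) : dot (x - y) z = dot x z - dot y z.
Proof. by rewrite dotC dotBr !(dotC z). Qed.

Lemma dot_CauchySchwarz n (x y : 'cV[R]_n) : dot x y ^+ 2 <= dot x x * dot y y.
Proof.
have [->|y0] := eqVneq y 0; first by rewrite !dot0r expr0n mulr0.
have yp : 0 < dot y y by rewrite lt0r dot_eq0 y0 dot_ge0.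
have := dot_ge0 (dot y y *: x - dot x y *: y).
rewrite !dotBl !dotBr !dotZl !dotZr [dot y x]dotC.
move: (dot x x) (dot x y) (dot y y) yp => a b c c0 h.
rewrite -(ler_pM2l c0) -subr_ge0; apply: le_trans h _.
by rewrite le_eqVlt; apply/orP; left; apply/eqP; ring.
Qed.

Lemma dot_le_frobnorm n (x y : 'cV[R]_n) : `|dot x y| <= frobnorm x * frobnorm y.
Proof.
rewrite -(@ler_pXn2r _ 2) ?nnegrE ?mulr_ge0 ?frobnorm_ge0 //.
by rewrite real_normK ?num_real // exprMn !frobnorm_dot dot_CauchySchwarz.
Qed.

Lemma frobnorm_tr m n (A : 'M[R]_(m, n)) : frobnorm A^T = frobnorm A.
Proof.
rewrite /frobnorm exchange_big; congr Num.sqrt.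
by apply: eq_bigr => i _; apply: eq_bigr => j _; rewrite mxE.
Qed.

Lemma frobnormZ m n c (A : 'M[R]_(m, n)) : frobnorm (c *: A) = `|c| * frobnorm A.
Proof.
rewrite /frobnorm -sqrtr_sqr -sqrtrM ?sqr_ge0 // mulr_sumr; congr Num.sqrt.
by apply: eq_bigr => i _; rewrite mulr_sumr; apply: eq_bigr => j _; rewrite mxE exprMn.
Qed.

Lemma frobnormN m n (A : 'M[R]_(m, n)) : frobnorm (- A) = frobnorm A.
Proof. by rewrite -scaleN1r frobnormZ normrN normr1 mul1r. Qed.

Lemma frobnorm0 m n : frobnorm (0 : 'M[R]_(m, n)) = 0.
Proof. by rewrite -(scale0r (0 : 'M[R]_(m, n))) frobnormZ normr0 mul0r. Qed.

Lemma frobnorm_rowD p (x y : 'rV[R]_p) : frobnorm (x + y) <= frobnorm x + frobnorm y.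
Proof.
rewrite -[frobnorm (x + y)]frobnorm_tr -(frobnorm_tr x) -(frobnorm_tr y) linearD /=.
move: x^T y^T => {x y} x y.
rewrite -(@ler_pXn2r _ 2) ?nnegrE ?addr_ge0 ?frobnorm_ge0 //.
rewrite sqrrD !frobnorm_dot dotDl !dotDr [dot y x]dotC.
have := dot_le_frobnorm x y; have := ler_norm (dot x y); lra.
Qed.

Lemma frobnorm_rowB p (x y : 'rV[R]_p) : frobnorm x - frobnorm y <= frobnorm (x + y).
Proof.
have := frobnorm_rowD (x + y) (- y); rewrite addrK frobnormN; lra.
Qed.

(** In a grid of side tau / (p + 1), two points of one cell are at distance at most tau, so
    separated points lie in distinct cells. The crude constant disappears in [packing_bound]. *)
Lemma grid_packing p (I : finType) (x : I -> 'rV[R]_p) (r tau : R) : 0 < tau -> 0 <= r ->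
  (forall i, frobnorm (x i) <= r) ->
  (forall i j, i != j -> tau < frobnorm (x i - x j)) ->
  #|I|%:R <= (2 * r * p.+1%:R / tau + 1) ^+ p.
Proof.
move=> tau0 r0 xr xsep; pose h := tau / p.+1%:R.
have pp : 0 < p.+1%:R :> R by rewrite ltr0n.
have h0 : 0 < h by rewrite divr_gt0.
have coord i k : `|x i 0 k| <= r.
  apply: le_trans (xr i); rewrite -(@ler_pXn2r _ 2) ?nnegrE ?frobnorm_ge0 //.
  rewrite frobnorm_sqr big_ord1 real_normK ?num_real // (bigD1 k) //= lerDl.
  by rewrite sumr_ge0 // => j _; rewrite sqr_ge0.
have cge0 i k : 0 <= (x i 0 k + r) / h.
  rewrite divr_ge0 ?(ltW h0) //; have := coord i k; rewrite ler_norml => /andP[]; lra.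
pose M := Num.trunc (2 * r / h).
have cell_lt i k : (Num.trunc ((x i 0 k + r) / h)%R < M.+1)%N.
  rewrite ltnS; apply: le_truncn.
  rewrite ler_pM2r ?invr_gt0 //; have := coord i k; rewrite ler_norml => /andP[]; lra.
pose F i : {ffun 'I_p -> 'I_M.+1} := [ffun k => Ordinal (cell_lt i k)].
have Finj : injective F.
  move=> i j Fij; apply/eqP; apply: contraT => ij.
  have := xsep _ _ ij; rewrite ltNge => /negP []; rewrite -(@ler_pXn2r _ 2) ?nnegrE ?frobnorm_ge0 ?(ltW tau0) //.
  have near k : (x i 0 k - x j 0 k) ^+ 2 <= h ^+ 2.
    have /(congr1 val) /= := congr1 (fun f : {ffun 'I_p -> 'I_M.+1} => f k) Fij.
    rewrite !ffunE /= => E.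
    have := truncn_itv (cge0 i k); have := truncn_itv (cge0 j k); rewrite E.
    move: (Num.trunc _) => N0; rewrite !ler_pdivlMr // !ltr_pdivrMr // -natr1 !mulrDl mul1r.
    move=> /andP[a1 a2] /andP[a3 a4].
    have : `|x i 0 k - x j 0 k| <= h by rewrite ler_norml; apply/andP; split; lra.
    by move=> hh; rewrite -[leLHS]real_normK ?num_real // lerXn2r ?nnegrE // ltW.
  rewrite frobnorm_sqr big_ord1; apply: (@le_trans _ _ (\sum_(k < p) h ^+ 2)).
    by apply: ler_sum => k _; rewrite !mxE.
  rewrite sumr_const card_ord -mulr_natl /h exprMn exprVn mulrA ler_pdivrMr ?exprn_gt0 //.
  rewrite mulrC ler_wpM2l ?sqr_ge0 // expr2 -natrM ler_nat.
  by rewrite (leq_trans (leqnSn p)) // leq_pmulr.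
have cI : (#|I| <= M.+1 ^ p)%N.
  have -> : (M.+1 ^ p)%N = #|{ffun 'I_p -> 'I_M.+1}| by rewrite card_ffun !card_ord.
  exact: leq_card Finj.
apply: (@le_trans _ _ (M.+1%:R ^+ p)); first by rewrite -natrX ler_nat.
have hE : 2 * r * p.+1%:R / tau = 2 * r / h by rewrite /h invf_div mulrA.
rewrite hE lerXn2r ?nnegrE ?addr_ge0 ?divr_ge0 ?mulr_ge0 ?(ltW h0) ?(ltW tau0) //.
have r2h : 0 <= 2 * r / h by rewrite divr_ge0 ?mulr_ge0 // ltW.
by rewrite -natr1 lerD2r; have /andP[] := truncn_itv r2h.
Qed.

(* Nested scaled copies x_{i_0} + theta x_{i_1} + theta^2 x_{i_2} + ... of the packing. *)
Lemma iterated_packing p (I : finType) (x : I -> 'rV[R]_p) (r rho : R) k :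
  0 < r -> 0 < rho -> (forall i, frobnorm (x i) <= r) ->
  (forall i j, i != j -> rho < frobnorm (x i - x j)) ->
  let theta := rho / (2 * r + rho) in
  exists (J : finType) (y : J -> 'rV[R]_p), [/\ #|J| = (#|I| ^ k)%N,
    forall j, frobnorm (y j) <= (r + rho / 2) * (1 - theta ^+ k) &
    forall i j, i != j -> rho * theta ^+ k < frobnorm (y i - y j)].
Proof.
move=> r0 rho0 xr xsep theta.
have den : 0 < 2 * r + rho by lra.
have th0 : 0 < theta by rewrite divr_gt0.
have th1 : theta <= 1 by rewrite ler_pdivrMr // mul1r; lra.
have thE : theta * (2 * r + rho) = rho by rewrite divfK // lt0r_neq0.
elim: k => [|k [J [y [cJ yr ysep]]]].
  exists unit, (fun=> 0); split => [|j|[] []] //; first by rewrite card_unit.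
  by rewrite frobnorm0 subrr mulr0.
exists (I * J)%type, (fun ij => x ij.1 + theta *: y ij.2); split.
- by rewrite card_prod cJ expnS.
- move=> [i j] /=; apply: le_trans (frobnorm_rowD _ _) _.
  rewrite frobnormZ gtr0_norm //.
  have : theta * frobnorm (y j) <= theta * ((r + rho / 2) * (1 - theta ^+ k)).
    by rewrite ler_pM2l.
  have := xr i; rewrite exprS.
  have -> : (r + rho / 2) * (1 - theta * theta ^+ k) =
     r + rho / 2 - theta * (2 * r + rho) / 2 + theta * ((r + rho / 2) * (1 - theta ^+ k)) by field.
  rewrite thE; lra.
- move=> [i j] [i' j'] /= ne.
  have -> : x i + theta *: y j - (x i' + theta *: y j') = (x i - x i') + theta *: (y j - y j').
    by rewrite opprD addrACA scalerBr.
  have [ii'|ii'] := eqVneq i i'.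
    have jj' : j != j' by apply: contraNneq ne => ->; rewrite ii'.
    by rewrite ii' subrr add0r frobnormZ gtr0_norm // exprS mulrCA ltr_pM2l // ysep.
  (* Around distinct centres, theta (2 r + rho) = rho makes each scaled copy have diameter at most
     rho (1 - theta^k), which leaves a gap above rho theta^k. *)
  apply: lt_le_trans (frobnorm_rowB _ _).
  rewrite frobnormZ gtr0_norm //.
  have h1 : theta * frobnorm (y j - y j') <= theta * (2 * ((r + rho / 2) * (1 - theta ^+ k))).
    rewrite ler_pM2l //; apply: le_trans (frobnorm_rowD _ _) _; rewrite frobnormN.
    by have := yr j; have := yr j'; lra.
  have h2 := xsep _ _ ii'.
  have E : theta * (2 * ((r + rho / 2) * (1 - theta ^+ k))) = rho * (1 - theta ^+ k).
    by rewrite -[X in _ = X * _]thE; field.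
  have : rho * theta ^+ k.+1 <= rho * theta ^+ k.
    by rewrite ler_pM2l // exprS ger_pMl // exprn_gt0.
  rewrite E in h1; lra.
Qed.

Lemma expr_bounded_le1 (a C : R) : 0 <= a -> (forall k, a ^+ k <= C) -> a <= 1.
Proof.
move=> a0 H; rewrite leNgt; apply/negP => a1.
have bern k : 1 + k%:R * (a - 1) <= a ^+ k.
  elim: k => [|k IHk]; first by rewrite mul0r addr0 expr0.
  have : 1 + k.+1%:R * (a - 1) <= a * (1 + k%:R * (a - 1)).
    rewrite -natr1 -subr_ge0.
    have -> : a * (1 + k%:R * (a - 1)) - (1 + (k%:R + 1) * (a - 1)) = k%:R * (a - 1) ^+ 2 by ring.
    by rewrite mulr_ge0 ?sqr_ge0.
  by move/le_trans; apply; rewrite exprS ler_wpM2l.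
pose k := (Num.trunc (C / (a - 1))).+1.
have : C / (a - 1) < k%:R by apply: truncnS_gt.
rewrite ltr_pdivrMr ?subr_gt0 //; have := H k; have := bern k; lra.
Qed.

(** Applying the grid bound to the k-fold nesting gives (n theta^p)^k <= C^p with C independent of
    k. Bounded powers force n theta^p <= 1. *)
Theorem packing_bound p (I : finType) (x : I -> 'rV[R]_p) (r rho : R) :
  0 < r -> 0 < rho -> (forall i, frobnorm (x i) <= r) ->
  (forall i j, i != j -> rho < frobnorm (x i - x j)) ->
  #|I|%:R <= ((2 * r + rho) / rho) ^+ p.
Proof.
move=> r0 rho0 xr xsep; pose theta := rho / (2 * r + rho).
have den : 0 < 2 * r + rho by lra.
have th0 : 0 < theta by rewrite divr_gt0.
have th1 : theta <= 1 by rewrite ler_pdivrMr // mul1r; lra.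
pose C := 2 * (r + rho / 2) * p.+1%:R / rho + 1.
have C0 : 0 <= 2 * (r + rho / 2) * p.+1%:R / rho.
  by rewrite divr_ge0 ?(ltW rho0) // mulr_ge0 // mulr_ge0 // addr_ge0 ?divr_ge0 ?ltW.
have H k : (#|I|%:R * theta ^+ p) ^+ k <= C ^+ p.
  have [J [y [cJ yr ysep]]] := iterated_packing k r0 rho0 xr xsep.
  have tk0 : 0 < theta ^+ k by rewrite exprn_gt0.
  have tk1 : theta ^+ k <= 1 by rewrite exprn_ile1 // ltW.
  have yr' j : frobnorm (y j) <= r + rho / 2.
    apply: le_trans (yr j) _; rewrite -[leRHS]mulr1 ler_wpM2l ?gerBl ?(ltW tk0) //.
    by rewrite addr_ge0 ?divr_ge0 ?ltW.
  have rr : 0 <= r + rho / 2 by rewrite addr_ge0 ?divr_ge0 ?ltW.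
  have := grid_packing (mulr_gt0 rho0 tk0) rr yr' ysep.
  rewrite cJ natrX [(#|I|%:R * _) ^+ k]exprMn [theta ^+ p ^+ k]exprAC => h.
  apply: (@le_trans _ _ ((2 * (r + rho / 2) * p.+1%:R / (rho * theta ^+ k) + 1) ^+ p * (theta ^+ k) ^+ p)).
    by rewrite ler_wpM2r // exprn_ge0 // ltW.
  rewrite -exprMn lerXn2r ?nnegrE ?mulr_ge0 ?(ltW tk0) ?addr_ge0 //.
    by rewrite divr_ge0 ?mulr_ge0 // ltW.
  rewrite mulrDl mul1r invfM mulrA divfK ?lt0r_neq0 //.
  by rewrite lerD2l.
have := expr_bounded_le1 _ H; rewrite mulr_ge0 ?exprn_ge0 ?(ltW th0) // => /(_ isT) h.
have -> : (2 * r + rho) / rho = theta^-1 by rewrite invf_div.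
by rewrite exprVn -[leRHS]mul1r ler_pdivlMr // exprn_gt0.
Qed.

(** A separated family of maximal size is a net, since a point far from all of it could be added;
    the packing bound ensures that a maximal size exists. *)
Lemma separated_net p (Theta : set 'rV[R]_p) (c : 'rV[R]_p) (r rho : R) :
  0 < r -> 0 < rho -> Theta `<=` [set t | frobnorm (t - c) <= r] ->
  exists (n : nat) (x : 'I_n -> 'rV[R]_p), [/\ forall i, Theta (x i),
    n%:R <= ((2 * r + rho) / rho) ^+ p,
    forall i j, i != j -> rho < frobnorm (x i - x j) &
    forall t, Theta t -> exists i, frobnorm (t - x i) <= rho].
Proof.
move=> r0 rho0 Tc.
pose P n := `[< exists x : 'I_n -> 'rV[R]_p, (forall i, Theta (x i)) /\
  (forall i j, i != j -> rho < frobnorm (x i - x j)) >].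
have P0 : exists n, P n.
  by exists 0%N; apply/asboolP; exists (fun=> 0); split; case.
have bnd n (x : 'I_n -> 'rV[R]_p) : (forall i, Theta (x i)) ->
    (forall i j, i != j -> rho < frobnorm (x i - x j)) -> n%:R <= ((2 * r + rho) / rho) ^+ p.
  move=> xT xsep; rewrite -[n in n%:R]card_ord.
  apply: (@packing_bound p _ (fun i => x i - c)) => // [i|i j ij]; first exact: Tc.
  by rewrite opprB addrA subrK; apply: xsep.
have Pm n : P n -> (n <= Num.trunc (((2 * r + rho) / rho) ^+ p)%R)%N.
  move=> /asboolP [x [xT xsep]]; rewrite truncn_ge_nat ?(bnd _ x) //.
  by rewrite exprn_ge0 // divr_ge0 ?ltW //; lra.
case: (ex_maxnP P0 Pm) => n /asboolP [x [xT xsep]] nmax.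
exists n, x; split => //; first exact: bnd xsep.
move=> t tT; apply: contrapT => far.
have far' i : rho < frobnorm (t - x i).
  by rewrite ltNge; apply/negP => h; apply: far; exists i.
suff /nmax : P n.+1 by rewrite ltnn.
apply/asboolP; exists (fun i => if unlift ord0 i is Some j then x j else t); split.
  by move=> i; case: unlift.
move=> i j; case: unliftP => [i' ->|->]; case: unliftP => [j' ->|->] //.
- by move=> ij; apply: xsep; apply: contraNneq ij => ->.
- by move=> _; rewrite -frobnormN opprB.
Qed.

End Packing.

(** * Norms, traces and deviations *)

Section NormsAndTraces.
Variable R : realType.

Lemma frobnorm_mulmx n (A : 'M[R]_n) (x : 'cV[R]_n) :
  frobnorm (A *m x) <= frobnorm A * frobnorm x.
Proof.
rewrite -(@ler_pXn2r _ 2) ?nnegrE ?mulr_ge0 ?frobnorm_ge0 // exprMn !frobnorm_sqr mulr_suml.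
apply: ler_sum => i _; rewrite big_ord1.
have -> : (A *m x) i 0 = dot (row i A)^T x.
  by rewrite mxE dotE; apply: eq_bigr => j _; rewrite !mxE.
apply: le_trans (dot_CauchySchwarz _ _) _; rewrite -frobnorm_sqr frobnorm_dot ler_wpM2r ?dot_ge0 //.
by rewrite dotE; apply: ler_sum => j _; rewrite !mxE expr2.
Qed.

Let specset n (A : 'M[R]_n) :=
  [set frobnorm (A *m x) | x in [set x : 'cV[R]_n | frobnorm x <= 1]].

Lemma specset0 n (A : 'M[R]_n) : specset A 0.
Proof. by exists 0 => /=; rewrite ?mulmx0 frobnorm0. Qed.

(** Boundedness makes the [sup] in [specnorm] a genuine supremum. *)
Lemma specset_ub n (A : 'M[R]_n) : ubound (specset A) (frobnorm A).
Proof.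
move=> _ [x x1 <-]; apply: le_trans (frobnorm_mulmx _ _) _.
by rewrite -[leRHS]mulr1 ler_wpM2l ?frobnorm_ge0.
Qed.

Lemma specnorm_ge n (A : 'M[R]_n) y : specset A y -> y <= specnorm A.
Proof. by move=> Ay; apply: ub_le_sup => //; exists (frobnorm A); exact: specset_ub. Qed.

Lemma specnorm_ge0 n (A : 'M[R]_n) : 0 <= specnorm A.
Proof. exact/specnorm_ge/specset0. Qed.

Lemma specnorm_le_frobnorm n (A : 'M[R]_n) : specnorm A <= frobnorm A.
Proof. by apply: ge_sup; [exists 0; exact: specset0 | exact: specset_ub]. Qed.

Lemma frobnorm_mulmx_spec n (A : 'M[R]_n) (x : 'cV[R]_n) :
  frobnorm (A *m x) <= specnorm A * frobnorm x.
Proof.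
have [->|x0] := eqVneq x 0; first by rewrite mulmx0 !frobnorm0 mulr0.
have fx : 0 < frobnorm x by rewrite lt0r frobnorm_eq0 x0 frobnorm_ge0.
rewrite -ler_pdivrMr // mulrC; apply: specnorm_ge; exists ((frobnorm x)^-1 *: x) => /=.
  by rewrite frobnormZ ger0_norm ?invr_ge0 ?(ltW fx) // mulVf // lt0r_neq0.
by rewrite -scalemxAr frobnormZ ger0_norm // invr_ge0 ltW.
Qed.

Lemma qf_specnorm n (A : 'M[R]_n) (x : 'cV[R]_n) : `|qf A x| <= specnorm A * dot x x.
Proof.
apply: le_trans (dot_le_frobnorm _ _) _.
by rewrite -frobnorm_dot expr2 mulrCA ler_wpM2l ?frobnorm_ge0 // frobnorm_mulmx_spec.
Qed.

Lemma frobnorm_mxfun n (U : 'M[R]_n) (d : 'rV[R]_n) f : U^T *m U = 1%:M ->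
  frobnorm (mxfun U d f) ^+ 2 = \sum_i f (d 0 i) ^+ 2.
Proof.
move=> UU; rewrite frobnorm_sqr -(tr_mxfun d (fun z => f z ^+ 2) UU).
have -> : mxfun U d (fun z => f z ^+ 2) = mxfun U d f *m (mxfun U d f)^T.
  by rewrite mxfun_sym mxfunM //; apply: eq_mxfun => i; rewrite expr2.
rewrite /mxtrace; apply: eq_bigr => i _; rewrite [RHS]mxE.
by apply: eq_bigr => j _; rewrite [(_^T) j i]mxE expr2.
Qed.

Lemma frobnorm_offdiag n (B : 'M[R]_n) : frobnorm (offdiag B) ^+ 2 <= frobnorm B ^+ 2.
Proof.
rewrite !frobnorm_sqr; apply: ler_sum => i _; apply: ler_sum => j _; rewrite mxE.
by case: ifP => // _; rewrite expr0n sqr_ge0.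
Qed.

Lemma rademacher_sqr n (s : {ffun 'I_n -> bool}) i : rademacher R s i 0 ^+ 2 = 1.
Proof. by rewrite mxE; case: ifP; rewrite ?sqrrN expr1n. Qed.

Lemma dot_rademacher n (s : {ffun 'I_n -> bool}) :
  dot (rademacher R s) (rademacher R s) = n%:R.
Proof.
rewrite dotE (eq_bigr (fun=> 1)) => [|i _]; last by rewrite -expr2 rademacher_sqr.
by rewrite sumr_const card_ord.
Qed.

(** Signs square to 1, so the diagonal contributes exactly the trace and the deviation is a chaos
    with zero diagonal. *)
Lemma qf_offdiag_rademacher n (B : 'M[R]_n) (s : {ffun 'I_n -> bool}) :
  qf (offdiag B) (rademacher R s) = qf B (rademacher R s) - \tr B.
Proof.
have {2}-> : B = offdiag B + diag_mx (\row_i B i i).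
  apply/matrixP => i j; rewrite !mxE; case: eqP => [->|_]; rewrite ?mulr1n ?add0r //.
  by rewrite mulr0n addr0.
rewrite qfD; have -> : qf (diag_mx (\row_i B i i)) (rademacher R s) = \tr B.
  rewrite /qf dotE /mxtrace; apply: eq_bigr => i _.
  rewrite mul_diag_mx [X in _ * X = _]mxE [X in _ * (X * _) = _]mxE mulrCA.
  by rewrite -expr2 rademacher_sqr mulr1.
by rewrite addrK.
Qed.

Lemma offdiag_sym n (B : 'M[R]_n) : B^T = B -> (offdiag B)^T = offdiag B.
Proof. by move=> BT; apply/matrixP => i j; rewrite !mxE eq_sym -{1}BT mxE. Qed.

Lemma mxtrace_qf n (D : 'M[R]_n) : \tr D = \sum_i qf D (delta_mx i 0).
Proof.
apply: eq_bigr => i _; rewrite /qf -colE dotE (bigD1 i) //= big1 ?addr0 => [|j ji].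
  by rewrite !mxE !eqxx mul1r.
by rewrite !mxE (negbTE ji) mul0r.
Qed.

Lemma mxtrace_qf_bound n (D : 'M[R]_n) c : (forall x, `|qf D x| <= c * dot x x) ->
  `|\tr D| <= c * n%:R.
Proof.
move=> Dc; rewrite mxtrace_qf; apply: le_trans (ler_norm_sum _ _ _) _.
apply: (@le_trans _ _ (\sum_(i < n) c)); last by rewrite sumr_const card_ord mulr_natr.
apply: ler_sum => i _; apply: le_trans (Dc _) _.
by rewrite /dot trmx_delta mul_delta_mx !mxE !eqxx mulr1.
Qed.

Lemma logdet_trace n (A U : 'M[R]_n) (d : 'rV[R]_n) : U^T *m U = 1%:M ->
  A = mxfun U d id -> (forall i, 0 < d 0 i) -> logdet A = \tr (mxfun U d (@ln R)).
Proof.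
move=> UU -> d0; rewrite /logdet det_mxfun // tr_mxfun //.
rewrite (eq_bigr (fun i => expR (ln (d 0 i)))) => [|i _]; last by rewrite lnK ?posrE.
by rewrite -expR_sum expRK.
Qed.

(** Two-sided form of [chaos_tail], applied to B and to -B. *)
Lemma chaos_deviation_count n N (B : 'M[R]_n) (S F2 t L : R) : B^T = B -> (forall i, B i i = 0) ->
  (forall x, `|qf B x| <= S * dot x x) -> 0 <= S -> frobnorm B ^+ 2 <= F2 -> 0 < t ->
  L * (8 * F2 + 4 * t * S) <= N%:R * t ^+ 2 ->
  #|[pred W : {ffun 'I_N -> {ffun 'I_n -> bool}} |
      t * N%:R < `|\sum_i qf B (rademacher R (W i))|]|%:R
  <= 2 * expR (- L) * #|{: {ffun 'I_N -> {ffun 'I_n -> bool}}}|%:R.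
Proof.
move=> BT B0 BS S0 BF t0 hN.
(* If F2 <= 0 then B = 0 and no sign pattern deviates; [chaos_tail] asks for F2 > 0. *)
have [F0|F0] := ltP 0 F2; last first.
  have Bz : B = 0.
    have /eqP : frobnorm B ^+ 2 = 0.
      by apply/eqP; rewrite eq_le (le_trans BF F0) sqr_ge0.
    rewrite frobnorm_sqr => /eqP /psumr_eq0P H; apply/matrixP => i j; rewrite mxE.
    have /psumr_eq0P := H (fun i _ => sumr_ge0 _ (fun j _ => sqr_ge0 _)) i isT.
    by move/(_ (fun j _ => sqr_ge0 _) j isT)/eqP; rewrite sqrf_eq0 => /eqP.
  rewrite eq_card0 ?mulr_ge0 ?expR_ge0 // => W; rewrite !inE big1 ?normr0.
    by apply/negbTE; rewrite -leNgt mulr_ge0 // ltW.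
  by move=> i _; rewrite Bz /qf mul0mx dot0r.
have NBT : (- B)^T = - B by rewrite linearN /= BT.
have NB0 i : (- B) i i = 0 by rewrite mxE B0 oppr0.
have NBS x : `|qf (- B) x| <= S * dot x x by rewrite qfN normrN.
have NBF : frobnorm (- B) ^+ 2 <= F2 by rewrite frobnormN.
have V0 : 0 < 8 * F2 + 4 * t * S by rewrite ltr_pwDl ?mulr_gt0 // !mulr_ge0 // ltW.
have le : expR (- (N%:R * t ^+ 2 / (8 * F2 + 4 * t * S))) <= expR (- L).
  by rewrite ler_expR lerN2 ler_pdivlMr.
have T1 := chaos_tail N BT B0 BS S0 BF F0 t0.
have T2 := chaos_tail N NBT NB0 NBS S0 NBF F0 t0.
set A1 := [pred W | _] in T1; set A2 := [pred W | _] in T2.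
apply: (@le_trans _ _ (#|A1|%:R + #|A2|%:R)).
  rewrite -natrD ler_nat -cardUI (leq_trans _ (leq_addr _ _)) //.
  apply/subset_leq_card/fintype.subsetP => W; rewrite !inE lter_normr.
  case/orP => [->//|]; rewrite -sumrN => h; apply/orP; right.
  by under eq_bigr => i _ do rewrite qfN.
set tot := (#|{: _}|%:R : R) in T1 T2 *.
have tot0 : 0 <= tot by rewrite ler0n.
have : expR (- (N%:R * t ^+ 2 / (8 * F2 + 4 * t * S))) * tot <= expR (- L) * tot by rewrite ler_wpM2r.
lra.
Qed.

End NormsAndTraces.

(** * Error of the estimator *)

Section SlqError.
Variable R : realType.

Definition spd_between n (alpha beta : R) (A : 'M[R]_n) := [/\ A^T = A,
  forall x, alpha * dot x x <= qf A x & forall x, qf A x <= beta * dot x x].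

Lemma spd_betweenP n (alpha beta : R) (A : 'M[R]_n) : sym_mx A ->
  loewner_le alpha%:M A -> loewner_le A beta%:M -> spd_between alpha beta A.
Proof.
move=> AT h1 h2; split=> // x; [have := h1 x|have := h2 x]; rewrite qfE qfB qf_scalar; lra.
Qed.

Variables (m : nat) (alpha beta : R).
Hypothesis al0 : 0 < alpha.

Lemma matlog_sym (A : 'M[R]_m) : spd_between alpha beta A -> (matlog A)^T = matlog A.
Proof.
by case=> AT Aal Abe; have [U [d [_ _ -> _]]] := matlogP AT al0 Aal Abe; rewrite mxfun_sym.
Qed.

Lemma logdet_matlog (A : 'M[R]_m) : spd_between alpha beta A -> logdet A = \tr (matlog A).
Proof.
case=> AT Aal Abe; have [U [d [UU AE -> db]]] := matlogP AT al0 Aal Abe.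
by apply: logdet_trace => // i; have /andP[/(lt_le_trans al0)] := db i.
Qed.

Lemma matlog_lipschitz (A B : 'M[R]_m) c :
  spd_between alpha beta A -> spd_between alpha beta B -> 0 <= c ->
  (forall x, `|qf (A - B) x| <= c * dot x x) ->
  forall x, `|qf (matlog A - matlog B) x| <= c / alpha * dot x x.
Proof.
case=> AT Aal Abe [BT Bal Bbe] c0 AB.
have [U [a [UU AE -> ab]]] := matlogP AT al0 Aal Abe.
have [V [b [VV BE -> bb]]] := matlogP BT al0 Bal Bbe.
apply: log_qf_lipschitz => // [i|i|]; [by case/andP: (ab i)|by case/andP: (bb i)|].
by rewrite -AE -BE.
Qed.

(** A crude bound, uniform in A: only its finiteness matters, to make the suprema over Theta genuine
    upper bounds. *)
Lemma frobnorm_matlog (A : 'M[R]_m) : spd_between alpha beta A ->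
  frobnorm (matlog A) ^+ 2 <= m%:R * (`|ln alpha| + `|ln beta|) ^+ 2.
Proof.
case=> AT Aal Abe; have [U [d [UU AE -> db]]] := matlogP AT al0 Aal Abe.
rewrite frobnorm_mxfun // mulr_natl -[m in _ *+ m]card_ord -sumr_const.
apply: ler_sum => i _; have /andP[d1 d2] := db i.
rewrite -[leLHS]real_normK ?num_real // lerXn2r ?nnegrE ?addr_ge0 //.
have dp : 0 < d 0 i := lt_le_trans al0 d1; have bp := lt_le_trans dp d2.
have : ln alpha <= ln (d 0 i) by rewrite ler_ln ?posrE.
have : ln (d 0 i) <= ln beta by rewrite ler_ln ?posrE.
rewrite ler_norml => h1 h2; apply/andP; split.
  by have := normr_ge0 (ln beta); have := ler_norm (- ln alpha); rewrite normrN; lra.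
by have := normr_ge0 (ln alpha); have := ler_norm (ln beta); lra.
Qed.

(** A0 stands for the nearest net point. Randomness enters only through the chaos at A0; the Lanczos
    error and the passage from A to A0, in the form and in the trace, are bounded for every sign
    pattern. *)
Lemma slq_error K N (A A0 : 'M[R]_m) (W : 'I_N -> {ffun 'I_m -> bool}) (p : {poly R})
    (e c t : R) :
  (0 < m)%N -> (0 < K)%N -> (0 < N)%N ->
  spd_between alpha beta A -> spd_between alpha beta A0 -> 0 <= c ->
  (forall x, `|qf (A - A0) x| <= c * dot x x) ->
  (size p <= K.*2)%N -> (forall z, alpha <= z <= beta -> `|ln z - p.[z]| <= e) ->
  `|\sum_i qf (offdiag (matlog A0)) (rademacher R (W i))| <= t * N%:R ->
  `|slq A K (fun i => rademacher R (W i)) - logdet A|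
    <= 2 * e * m%:R + 2 * (c / alpha * m%:R) + t.
Proof.
move=> m0 K0 N0 hA hA0 c0 AA0 sp pe dev; rewrite (logdet_matlog hA).
have Np : 0 < N%:R :> R by rewrite ltr0n.
have Lip := matlog_lipschitz hA hA0 c0 AA0.
have trLip := mxtrace_qf_bound Lip.
set LA := matlog A in Lip trLip *; set L0 := matlog A0 in dev Lip trLip *.
have E : slq A K (fun i => rademacher R (W i)) - \tr LA =
  N%:R^-1 * (\sum_i (lanczos_quad A K (rademacher R (W i)) - qf LA (rademacher R (W i))
     + (qf (LA - L0) (rademacher R (W i)) - \tr (LA - L0)))
     + \sum_i qf (offdiag L0) (rademacher R (W i))).
  rewrite -big_split /= /slq.
  rewrite [X in _ - X](_ : _ = N%:R^-1 * \sum_(i < N) \tr LA); last first.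
    by rewrite sumr_const card_ord -[\tr LA *+ N]mulr_natl mulKf // lt0r_neq0.
  rewrite -mulrBr -sumrB; congr (_ * _); apply: eq_bigr => i _.
  by rewrite qf_offdiag_rademacher qfB [\tr (_ - _)]raddfB /=; ring.
rewrite E normrM gtr0_norm ?invr_gt0 // mulrC ler_pdivrMr //.
apply: le_trans (ler_normD _ _) _; rewrite mulrDl lerD //.
apply: le_trans (ler_norm_sum _ _ _) _.
apply: (@le_trans _ _ (\sum_(i < N) (2 * e * m%:R + 2 * (c / alpha * m%:R)))); last first.
  by rewrite sumr_const card_ord -[leLHS]mulr_natr.
apply: ler_sum => i _.
have w0 : rademacher R (W i) != 0.
  by rewrite -dot_eq0 dot_rademacher pnatr_eq0 -lt0n.
have [AT Aal Abe] := hA.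
have h1 := lanczos_quad_error AT al0 Aal Abe w0 K0 sp pe.
have h2 := Lip (rademacher R (W i)).
rewrite dot_rademacher in h1 h2.
apply: le_trans (ler_normD _ _) _; rewrite lerD //.
apply: le_trans (ler_normB _ _) _; rewrite [leRHS]mulrDl mul1r lerD //.
Qed.

End SlqError.

(** * Union bound over the net and conclusion *)

Lemma card_bigcover (T : finType) n (A : pred T) (B : 'I_n -> pred T) :
  (forall x, A x -> exists i, B i x) -> (#|A| <= \sum_i #|B i|)%N.
Proof.
move=> AB; rewrite -sum1_card.
under [X in (_ <= X)%N]eq_bigr => i _ do rewrite -sum1_card big_mkcond /=.
rewrite exchange_big big_mkcond /=; apply: leq_sum => x _.
case: ifP => // /AB [i Bi]; rewrite (bigD1 i) //=.
by rewrite unfold_in Bi.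
Qed.

Theorem theorem4p3 (R : realType) (m p K N : nat)
  (Theta : set 'rV[R]_p) (Psi : 'rV[R]_p -> 'M[R]_m)
  (delta eps r LPsi alpha beta : R) :
  (0 < m)%N -> (0 < K)%N -> (0 < N)%N ->
  0 < delta < 1 -> 0 < eps ->
  compact Theta -> 0 < r ->
  (exists c : 'rV[R]_p, Theta `<=` [set t | frobnorm (t - c) <= r]) ->
  0 < LPsi ->
  (forall t t', Theta t -> Theta t' ->
     specnorm (Psi t - Psi t') <= LPsi * frobnorm (t - t')) ->
  0 < alpha -> alpha <= beta ->
  (forall t, Theta t -> sym_mx (Psi t)) ->
  (forall t, Theta t -> loewner_le (alpha%:M) (Psi t) /\ loewner_le (Psi t) (beta%:M)) ->
  let kappa := beta / alpha in
  let eta := alpha * eps / (5 * m%:R * LPsi) in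
  let gamma := Num.max ((3 * r / eta) ^+ p) 1 in
  K%:R >= Num.sqrt (kappa + 1) / 4 *
          ln (4 * (5 / 2) * eps^-1 * m%:R * (Num.sqrt (kappa + 1) + 1) * ln (2 * kappa)) ->
  N%:R >= 32 * (25 / 4 * eps ^- 2 *
                  sup [set frobnorm (offdiag (matlog (Psi t))) ^+ 2 | t in Theta]
                + 5 / 2 * eps^-1 *
                  sup [set specnorm (offdiag (matlog (Psi t))) | t in Theta])
             * ln (2 * gamma / delta) ->
  rad_prob R (fun W : {ffun 'I_N -> {ffun 'I_m -> bool}} =>
     forall t, Theta t ->
       `|slq (Psi t) K (fun i => rademacher R (W i)) - logdet (Psi t)| <= eps)
  >= 1 - delta.
Proof.
move=> m0 K0 N0 /andP[de0 de1] e0 _ r0 [ctr Tc] L0 PL al0 ab Psym Pb kappa eta gamma HK HN.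
have mp : 0 < m%:R :> R by rewrite ltr0n.
have Np : 0 < N%:R :> R by rewrite ltr0n.
have et0 : 0 < eta by rewrite divr_gt0 ?mulr_gt0.
have PB t : Theta t -> spd_between alpha beta (Psi t).
  by move=> Tt; apply: spd_betweenP; [exact: Psym|case: (Pb t Tt)|case: (Pb t Tt)].
set F2 := sup [set frobnorm _ ^+ 2 | t in Theta] in HN.
set S := sup [set specnorm _ | t in Theta] in HN.
pose C := m%:R * (`|ln alpha| + `|ln beta|) ^+ 2.
have FC t : Theta t -> frobnorm (offdiag (matlog (Psi t))) ^+ 2 <= C.
  move=> Tt; apply: le_trans (frobnorm_offdiag _) _; exact: frobnorm_matlog (PB t Tt).
have FF2 t : Theta t -> frobnorm (offdiag (matlog (Psi t))) ^+ 2 <= F2.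
  move=> Tt; apply: ub_le_sup; last by exists t.
  by exists C => _ [u Tu <-]; exact: FC.
have SS t : Theta t -> specnorm (offdiag (matlog (Psi t))) <= S.
  move=> Tt; apply: ub_le_sup; last by exists t.
  (* f <= f^2 + 1 turns the bound on the squared norm into one on the norm. *)
  exists (C + 1) => _ [u Tu <-]; apply: le_trans (specnorm_le_frobnorm _) _.
  have := FC u Tu; move: (frobnorm _) => f fC.
  by have := sqr_ge0 f; have := sqr_ge0 (f - 1); rewrite sqrrB1; lra.
have [e [q [sq qe me]]] := ln_poly_approx_rate al0 ab e0 m0 K0 HK.
(* If eta <= 5 r / 3, then 1 + 2 r / rho <= 3 r / eta. Otherwise rho > 2 r and the net has at most
   one point. Either way its size is at most gamma. *)
pose rho := 3 / 2 * eta.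
have rho0 : 0 < rho by rewrite mulr_gt0 // divr_gt0.
have [n [x [xT nb xsep xnet]]] := separated_net r0 rho0 Tc.
have gam1 : 1 <= gamma by rewrite le_max lexx orbT.
have ngam : n%:R <= gamma.
  have [le3|lt3] := leP ((2 * r + rho) / rho) (3 * r / eta).
    rewrite le_max; apply/orP; left; apply: le_trans nb _; rewrite lerXn2r ?nnegrE //.
      by apply: divr_ge0; [lra|exact: ltW].
    by apply: divr_ge0; [lra|exact: ltW].
  apply: le_trans gam1; rewrite (ler_nat R n 1) leqNgt; apply/negP => n1.
  have i01 : Ordinal (ltnW n1) != Ordinal n1 by [].
  have := xsep _ _ i01; rewrite ltNge => /negP; apply.
  have := Tc _ (xT (Ordinal (ltnW n1))); have := Tc _ (xT (Ordinal n1)) => /=.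
  move: (x _) (x _) => u v hu hv.
  have -> : u - v = (u - ctr) + - (v - ctr) by rewrite opprB addrA subrK.
  apply: le_trans (frobnorm_rowD _ _) _; rewrite frobnormN.
  move: lt3; rewrite ltr_pdivlMr // mulrAC ltr_pdivrMr //; rewrite /rho; nra.
set L := ln (2 * gamma / delta) in HN.
have gd : 0 < 2 * gamma / delta by rewrite divr_gt0 // mulr_gt0 // (lt_le_trans ltr01).
have Lp : 0 <= L by rewrite ln_ge0 // ler_pdivlMr //; lra.
pose t0 := eps / 5.
pose bad i := [pred W : {ffun 'I_N -> {ffun 'I_m -> bool}} |
  t0 * N%:R < `|\sum_k qf (offdiag (matlog (Psi (x i)))) (rademacher R (W k))|].
set tot := (#|{: {ffun 'I_N -> {ffun 'I_m -> bool}}}|%:R : R).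
have tot0 : 0 < tot.
  by rewrite ltr0n; apply/card_gt0P; exists [ffun=> [ffun=> true]].
have badP i : #|bad i|%:R <= delta / gamma * tot.
  have S0 : 0 <= S := le_trans (specnorm_ge0 _) (SS _ (xT i)).
  have F20 : 0 <= F2 := le_trans (sqr_ge0 _) (FF2 _ (xT i)).
  have -> : delta / gamma = 2 * expR (- L).
    rewrite expRN lnK ?posrE // invf_div; field; rewrite gt_eqF //.
    exact: lt_le_trans ltr01 gam1.
  apply: (@chaos_deviation_count _ _ _ _ S F2).
  - exact/offdiag_sym/matlog_sym/(PB _ (xT i)).
  - by move=> k; rewrite mxE eqxx.
  - move=> y; apply: le_trans (qf_specnorm _ _) _; rewrite ler_wpM2r ?dot_ge0 //; exact/SS/xT.
  - exact: S0.
  - exact/FF2/xT.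
  - by rewrite divr_gt0.
  (* Multiplied by eps^2 / 25, the assumption on N reads L (8 F2 + 16/5 eps S) <= N t0^2, whereas t0
     = eps / 5 asks only for 4/5 eps S in the second term. *)
  - have -> : N%:R * t0 ^+ 2 = eps ^+ 2 / 25 * N%:R by rewrite /t0; field.
    have : eps ^+ 2 / 25 * (32 * (25 / 4 * eps ^- 2 * F2 + 5 / 2 * eps^-1 * S) * L)
       <= eps ^+ 2 / 25 * N%:R by rewrite ler_wpM2l // divr_ge0 ?sqr_ge0.
    have -> : eps ^+ 2 / 25 * (32 * (25 / 4 * eps ^- 2 * F2 + 5 / 2 * eps^-1 * S) * L)
      = L * (8 * F2 + 16 / 5 * (eps * S)) by field; rewrite gt_eqF.
    apply: le_trans; rewrite ler_wpM2l // lerD2l /t0.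
    have : 0 <= eps * S by rewrite mulr_ge0 // ltW.
    lra.
pose good := fun W : {ffun 'I_N -> {ffun 'I_m -> bool}} => forall t, Theta t ->
       `|slq (Psi t) K (fun i => rademacher R (W i)) - logdet (Psi t)| <= eps.
(* A sign pattern with small deviation at every net point is good on all of Theta. *)
have cover W : ~~ `[< good W >] -> exists i, bad i W.
  move=> /asboolPn ng; apply: contrapT => nb'; apply: ng => t Tt.
  have [i ti] := xnet t Tt.
  have dev : `|\sum_k qf (offdiag (matlog (Psi (x i)))) (rademacher R (W k))| <= t0 * N%:R.
    by rewrite leNgt; apply/negP => h; apply: nb'; exists i.
  have c0 : 0 <= LPsi * rho by apply: mulr_ge0; exact: ltW.
  have close y : `|qf (Psi t - Psi (x i)) y| <= LPsi * rho * dot y y.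
    apply: le_trans (qf_specnorm _ _) _; rewrite ler_wpM2r ?dot_ge0 //.
    apply: le_trans (PL _ _ Tt (xT i)) _; by rewrite ler_wpM2l // ltW.
  have := slq_error al0 m0 K0 N0 (PB t Tt) (PB _ (xT i)) c0 close sq qe dev.
  move/le_trans; apply.
  (* The budget is eps / 5 for Lanczos, twice 3 eps / 10 for the move to the net point, and eps / 5
     for the chaos. *)
  have -> : LPsi * rho / alpha * m%:R = 3 / 10 * eps.
    by rewrite /rho /eta; field; rewrite !gt_eqF.
  by rewrite /t0; lra.
rewrite /rad_prob -/tot ler_pdivlMr //.
have totE : tot = #|[pred W | `[< good W >]]|%:R + #|[pred W | ~~ `[< good W >]]|%:R.
  rewrite /tot -natrD; congr (_%:R).
  by rewrite -[LHS](cardC [pred W | `[< good W >]]); congr (_ + _)%N; apply: eq_card.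
have -> : #|[set W | `[< good W >]]| = #|[pred W | `[< good W >]]|.
  by apply: eq_card => W; apply/idP/idP => [/set_mem|h]; [|exact/mem_set].
have : #|[pred W | ~~ `[< good W >]]|%:R <= delta * tot.
  apply: (@le_trans _ _ (\sum_i #|bad i|%:R)).
    rewrite -natr_sum ler_nat; apply: card_bigcover => W; exact: cover.
  (* At most gamma net points, each failing for a fraction of at most delta / gamma of the sign
     patterns. *)
  apply: (@le_trans _ _ (\sum_(i < n) (delta / gamma * tot))); first exact: ler_sum.
  rewrite sumr_const card_ord -mulr_natl mulrA ler_wpM2r ?(ltW tot0) //.
  have gp : 0 < gamma := lt_le_trans ltr01 gam1.
  by rewrite mulrA ler_pdivrMr // mulrC ler_wpM2l // ltW.
by move: totE; lra.
Qed.
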